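(* Let $M\in\mathbb{N}$, $t\in(0,1)$ and $L>0$, let $\tilde\Omega^M_{t,L}$ be the class of operators defined in the context, and for $T\in\tilde\Omega^M_{t,L}$ let $\Xi_3(T)=\mathrm{ran}(P)$ be its dominant invariant subspace, considered in the space of $M$-dimensional subspaces of $l^2(\mathbb{N})$ equipped with the metric $\hat\delta$. Then $\{\Xi_3,\tilde\Omega^M_{t,L}\}\in\Delta_1$. In other words, for all $n\in\mathbb{N}$ there exists a general tower using radicals, $\Gamma_n$, each $\Gamma_n(T)$ an $M$-dimensional subspace of $l^2(\mathbb{N})$, such that for all $T\in\tilde\Omega^M_{t,L}$, $$\hat\delta(\Gamma_n(T),\Xi_3(T))\le2^{-n}.$$
   Context: $\{e_j\}$ is the canonical basis of $l^2(\mathbb{N})$; $P_m$ is the orthogonal projection onto $\mathrm{span}\{e_1,\dots,e_m\}$. For closed subspaces $M_1,M_2$ with orthogonal projections $E,F$, $\hat\delta(M_1,M_2)=\|E-F\|$, and the subspace angle $\phi(M_1,M_2)\in[0,\pi/2]$ is defined by $\sin\phi(M_1,M_2)=\hat\delta(M_1,M_2)$. The class $\tilde\Omega^M_{t,L}$ consists of the invertible $T\in\mathcal{B}(l^2(\mathbb{N}))$ (not necessarily normal) for which there exist an orthogonal projection $P$ of rank $M$ with $\mathrm{ran}(P)$ invariant under $T$, and $\alpha>\beta>0$ with $\|Tx\|\ge\alpha\|x\|$ for all $x\in\mathrm{ran}(P)$ and $\|(I-P)T(I-P)\|\le\beta$, such that $\{\tilde Pe_j\}_{j=1}^M$ are linearly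 independent, where $\tilde P$ is the orthogonal projection onto the subspace $S$ defined below, and moreover 1. $\beta/\alpha<t$; 2. $\displaystyle\max\Big\{\|T\|,\ \frac{\sin(\phi(\mathrm{span}\{e_j\}_{j=1}^M,\mathrm{ran}(P)))}{\cos(\phi(\mathrm{span}\{e_j\}_{j=1}^M,S))}\Big(1+\frac{\|PT(I-P)\|}{\alpha-\beta}\Big)\Big\}\le L$. The subspace $S$: with respect to $l^2(\mathbb{N})=\mathrm{ran}(P)\oplus\mathrm{ran}(I-P)$ write $T=\begin{pmatrix}T_{11}&T_{12}\\0&T_{22}\end{pmatrix}$. Let $A:\mathrm{ran}(I-P)\to\mathrm{ran}(P)$ be the bounded operator determined by $A-T_{11}^{-1}AT_{22}=-T_{11}^{-1}T_{12}$. Then $S=\{x-A^*x:x\in\mathrm{ran}(P)\}$, an $M$-dimensional $T^*$-invariant subspace. Available information: on an input $T$ the algorithms may use the matrix entries $\langle Te_j,e_i\rangle$ and the values of given increasing functions $g^j:\mathbb{N}\to\mathbb{N}$ ($j\in\mathbb{N}$) such that the infinite matrix $T_{(j)}$ with columns $\{P_{g^j(n)}Te_n\}_{n\in\mathbb{N}}$ is invertible and $\|(P_{g^j(n)}-I)Te_n\|\le1/j$ for all $n\in\mathbb{N}$; $M,t,L$ are known. Algorithms: a general algorithm is a map $\Gamma:\Omega\to\mathcal{M}$ ($\mathcal{M}$ the metric space of outputs) such that for each $T$ there is a finite set $\Lambda_\Gamma(T)$ of evaluations of the available information on which alone $\Gamma(T)$ depends, and such that $\Lambda_\Gamma(B)=\Lambda_\Gamma(T)$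 whenever $B$ agrees with $T$ on $\Lambda_\Gamma(T)$. It is radical (''using radicals'') if its action consists of finitely many arithmetic operations, comparisons and extractions of square roots of positive numbers on these evaluations (a subspace is output through a finite spanning set of finitely supported vectors). $\{\Xi,\Omega\}\in\Delta_1$ means there is a sequence $\{\Gamma_n\}$ of radical general algorithms with $d_{\mathcal{M}}(\Gamma_n(T),\Xi(T))\le2^{-n}$ for all $T\in\Omega$ and $n\in\mathbb{N}$. *)

(* Defs.v *)
From HB Require Import structures.
From mathcomp Require Import all_boot all_order all_algebra.
From mathcomp Require Import complex ring.
From mathcomp Require Import all_classical all_reals all_analysis.

Set Implicit Arguments.
Unset Strict Implicit.
Unset Printing Implicit Defensive.

Import Order.TTheory GRing.Theory Num.Theory.
Import numFieldNormedType.Exports.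

Local Open Scope classical_set_scope.
Local Open Scope ring_scope.

(** * The Hilbert space l^2(N), with complex scalars R[i] *)

Section Ell2Space.
Variable R : realType.

Definition sqmod (z : R[i]) : R := complex.Re z ^+ 2 + complex.Im z ^+ 2.

Definition square_summable : {pred nat -> R[i]} :=
  fun u => `[< cvgn (series (fun k => sqmod (u k))) >].

Lemma sqmod_ge0 (z : R[i]) : 0 <= sqmod z.
Proof. by rewrite addr_ge0 ?sqr_ge0. Qed.

Lemma sqmodM (z w : R[i]) : sqmod (z * w) = sqmod z * sqmod w.
Proof. by case: z w => [a b] [c d]; rewrite /sqmod /=; ring. Qed.

Lemma sqmodD_le (z w : R[i]) : sqmod (z + w) <= 2 * sqmod z + 2 * sqmod w.
Proof.
case: z w => [a b] [c d]; rewrite /sqmod /= -subr_ge0.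
have -> : 2 * (a ^+ 2 + b ^+ 2) + 2 * (c ^+ 2 + d ^+ 2) -
  ((a + c) ^+ 2 + (b + d) ^+ 2) = (a - c) ^+ 2 + (b - d) ^+ 2 by ring.
by rewrite addr_ge0 ?sqr_ge0.
Qed.

Lemma square_summable_submod : GRing.submod_closed square_summable.
Proof.
split=> [|a u v]; rewrite !unfold_in.
  apply/asboolP; apply: (cvgP 0); apply: cvg_near_cst; near=> n.
  by rewrite /series /= big1// => i _; rewrite /sqmod /= expr0n addr0.
move=> /asboolP hu /asboolP hv; apply/asboolP.
apply: (@series_le_cvg _ _
  ((2 * sqmod a) *: (fun k => sqmod (u k)) + 2 *: (fun k => sqmod (v k)))).
- by move=> n; exact: sqmod_ge0.
- by move=> n; rewrite addr_ge0// mulr_ge0 ?mulr_ge0 ?sqmod_ge0.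
- move=> n; apply: le_trans (sqmodD_le _ _) _.
  by have -> : (a *: u) n = a * u n by []; rewrite sqmodM mulrA.
- by apply: is_cvg_seriesD; exact: is_cvg_seriesZ.
Unshelve. all: by end_near. Qed.

HB.instance Definition _ :=
  GRing.isSubmodClosed.Build R[i] (nat -> R[i]) square_summable
    square_summable_submod.

Record ell2 := Ell2 { ell2_seq :> nat -> R[i] ; _ : square_summable ell2_seq }.

HB.instance Definition _ := [isSub for ell2_seq].
HB.instance Definition _ := [Choice of ell2 by <:].
HB.instance Definition _ := [SubChoice_isSubZmodule of ell2 by <:].
HB.instance Definition _ := [SubZmodule_isSubLmodule of ell2 by <:].

Definition delta_seq (j k : nat) : R[i] := (k == j)%:R.

Lemma delta_seq_summable j : square_summable (delta_seq j).
Proof.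
apply/asboolP/cvg_ex; exists (1 : R); apply: cvg_near_cst; near=> n.
have jn : (j < n)%N by near: n; exact: nbhs_infty_gt.
rewrite /series /= (bigD1_seq j) ?mem_index_iota ?iota_uniq//= big1 => [|i ij].
  by rewrite /delta_seq eqxx /sqmod /= expr1n expr0n !addr0.
by rewrite /delta_seq (negbTE ij) /sqmod /= expr0n addr0.
Unshelve. all: by end_near. Qed.

Definition e_ (j : nat) : ell2 := Ell2 (delta_seq_summable j).

End Ell2Space.

Section Operators.
Variable R : realType.
Local Notation H := (ell2 R).

(* <x, y>, linear in x and conjugate-linear in y *)
Definition dot (x y : H) : R[i] :=
  Complex (limn (series (fun k => complex.Re (x k * (y k)^*))))
          (limn (series (fun k => complex.Im (x k * (y k)^*)))).

Definition l2norm (x : H) : R := Num.sqrt (complex.Re (dot x x)).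

Definition bounded_op (T : H -> H) : Prop :=
  linear T /\ exists C : R, forall x, l2norm (T x) <= C * l2norm x.

(* Meaningful for bounded operators; [sup] is 0 on an unbounded set. *)
Definition opnorm (T : H -> H) : R :=
  sup [set l2norm (T x) | x in [set x | l2norm x <= 1]].

Definition invertible_op (T : H -> H) : Prop :=
  bounded_op T /\ exists T', [/\ bounded_op T', cancel T T' & cancel T' T].

Definition adjoint_pair (A B : H -> H) : Prop :=
  forall x y, dot (A x) y = dot x (B y).

Definition orthogonal_projection (P : H -> H) : Prop :=
  [/\ linear P, (forall x, P (P x) = P x) & adjoint_pair P P].

(* The orthogonal projection onto V; the zero map if V is not the range of an
   orthogonal projection, i.e. not a closed subspace. *)
Definition oproj (V : set H) : H -> H :=
  xget (fun=> 0) [set E | orthogonal_projection E /\ range E = V].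

Definition span (n : nat) (v : 'I_n -> H) : set H :=
  [set x | exists c : 'I_n -> R[i], x = \sum_(i < n) c i *: v i].

Definition lin_indep (n : nat) (v : 'I_n -> H) : Prop :=
  forall c : 'I_n -> R[i], \sum_(i < n) c i *: v i = 0 -> forall i, c i = 0.

Definition has_dim (n : nat) (V : set H) : Prop :=
  exists v : 'I_n -> H, lin_indep v /\ V = span v.

(* span{e_1, ..., e_m} of the mathematical, 1-based, numbering *)
Definition span_e (m : nat) : set H := span (fun j : 'I_m => e_ R j).

Definition delta_hat (V W : set H) : R :=
  opnorm (fun x => oproj V x - oproj W x).

(* asin takes values in [0, pi/2] here, since delta_hat lies in [0, 1]. *)
Definition angle (V W : set H) : R := asin (delta_hat V W).

End Operators.

Section DominantSubspace.
Variable R : realType.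
Local Notation H := (ell2 R).

(* Blocks of T with respect to H = ran P (+) ran (I - P): T11 and T12 are both
   given by x |-> P (T x), on ran P and on ran (I - P) respectively, and T22 by
   x |-> T x - P (T x) on ran (I - P).  T11i is the inverse of T11 on ran P.
   The operator A : ran (I - P) -> ran P is extended to H by 0 on ran P, so its
   adjoint maps ran P to ran (I - P) and vanishes on ran (I - P). *)
Definition sylvester_solution (T P A : H -> H) : Prop :=
  [/\ bounded_op A,
      (forall x, A x = P (A (x - P x))) &
      exists T11i : H -> H,
        (forall x, range P x ->
           [/\ range P (T11i x), T11i (P (T x)) = x & P (T (T11i x)) = x]) /\
        (forall v, range (fun x => x - P x) v ->
           A v - T11i (A (T v - P (T v))) = - T11i (P (T v)))].

Definition complement_subspace (T P : H -> H) (S : set H) : Prop :=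
  exists A Astar : H -> H,
    [/\ sylvester_solution T P A, adjoint_pair A Astar &
        S = [set x - Astar x | x in range P]].

Definition dominant_projection (M : nat) (t L : R) (T P : H -> H) : Prop :=
  [/\ orthogonal_projection P, has_dim M (range P),
      (forall x, range P x -> range P (T x)) &
      exists (alpha beta : R) (S : set H),
      [/\ 0 < beta < alpha,
          (forall x, range P x -> alpha * l2norm x <= l2norm (T x)),
          opnorm (fun x => T (x - P x) - P (T (x - P x))) <= beta &
          [/\ complement_subspace T P S,
              lin_indep (fun j : 'I_M => oproj S (e_ R j)),
              beta / alpha < t &
              Num.max (opnorm T)
                (sin (angle (span_e M) (range P)) / cos (angle (span_e M) S) *
                 (1 + opnorm (fun x => P (T (x - P x))) / (alpha - beta)))
              <= L]]].

Definition Omega_tilde (M : nat) (t L : R) : set (H -> H) :=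
  [set T | invertible_op T /\ exists P, dominant_projection M t L T P].

Definition Xi3 (M : nat) (t L : R) (T : H -> H) : set H :=
  xget set0 [set V | exists P, dominant_projection M t L T P /\ V = range P].

End DominantSubspace.

Section Algorithms.
Variable R : realType.
Local Notation H := (ell2 R).

(** ** Available information *)

(* An operator T together with the functions g^1, g^2, ...; [g j] is g^(j+1),
   and e_ n is numbered from 0. *)
Definition input : Type := (H -> H) * (nat -> nat -> nat).

Definition trunc (m : nat) : H -> H := oproj (@span_e R m).

Definition admissible (T : H -> H) (g : nat -> nat -> nat) : Prop :=
  forall j,
    [/\ {homo g j : m n / (m <= n)%N},
        (exists Tj, invertible_op Tj /\
           forall n, Tj (e_ R n) = trunc (g j n) (T (e_ R n))) &
        forall n, l2norm (trunc (g j n) (T (e_ R n)) - T (e_ R n))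
                  <= j.+1%:R^-1].

Definition inputs (Om : set (H -> H)) : set input :=
  [set x | Om x.1 /\ admissible x.1 x.2].

Inductive evaluation : Type :=
| Entry of nat & nat   (* Entry i j : <T e_j, e_i> *)
| Gval of nat & nat.   (* Gval j n : g^(j+1) at n *)

Definition evaluate (x : input) (f : evaluation) : R[i] :=
  match f with
  | Entry i j => dot (x.1 (e_ R j)) (e_ R i)
  | Gval j n => (x.2 j n)%:R
  end.

(** ** Computations with radicals *)

(* Real arithmetic expressions in the real and imaginary parts of evaluations,
   the rational constants and the known parameters of the problem. *)
Inductive term : Type :=
| ReEval of evaluation
| ImEval of evaluation
| Param of nat
| Const of rat
| Add of term & term
| Sub of term & term
| Mul of term & term
| Div of term & term
| Sqrt of term.

Fixpoint value (par : seq R) (x : input) (u : term) : R :=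
  match u with
  | ReEval f => complex.Re (evaluate x f)
  | ImEval f => complex.Im (evaluate x f)
  | Param k => par`_k
  | Const q => ratr q
  | Add u v => value par x u + value par x v
  | Sub u v => value par x u - value par x v
  | Mul u v => value par x u * value par x v
  | Div u v => value par x u / value par x v
  | Sqrt u => Num.sqrt (value par x u)
  end.

(* u only uses evaluations from Lam, and on x never divides by 0 nor takes the
   square root of a number that is not positive. *)
Fixpoint legal (par : seq R) (x : input) (Lam : set evaluation) (u : term) :
    Prop :=
  match u with
  | ReEval f | ImEval f => Lam f
  | Param k => (k < size par)%N
  | Const _ => True
  | Add u v | Sub u v | Mul u v => legal par x Lam u /\ legal par x Lam v
  | Div u v =>
      [/\ legal par x Lam u, legal par x Lam v & value par x v != 0]
  | Sqrt u => legal par x Lam u /\ 0 < value par x u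
  end.

(* Decision trees.  The tree may be infinite (the number of operations is not
   bounded uniformly in the input), but [computes] below only holds on inputs
   whose branch is finite.  A leaf lists k vectors supported in the first l
   coordinates, as pairs (real part, imaginary part). *)
CoInductive tree : Type :=
| Less of term & term & tree & tree
| Output (k l : nat) of ('I_k -> 'I_l -> term * term).

Inductive computes (par : seq R) (x : input) (Lam : set evaluation) :
    tree -> set H -> Prop :=
| computes_less u v p q V :
    legal par x Lam u -> legal par x Lam v ->
    computes par x Lam (if value par x u < value par x v then p else q) V ->
    computes par x Lam (Less u v p q) V
| computes_output k l (W : 'I_k -> 'I_l -> term * term) :
    (forall i j, legal par x Lam (W i j).1 /\ legal par x Lam (W i j).2) ->
    computes par x Lam (Output W)
      (span (fun i : 'I_k => \sum_(j < l)
         Complex (value par x (W i j).1) (value par x (W i j).2) *: e_ R j)).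

(** ** Towers of algorithms *)

Definition general_algorithm (Om : set input) (Gam : input -> set H)
    (Lam : input -> set evaluation) : Prop :=
  forall x, Om x ->
    finite_set (Lam x) /\
    forall y, Om y -> (forall f, Lam x f -> evaluate y f = evaluate x f) ->
      Gam y = Gam x /\ Lam y = Lam x.

Definition radical_algorithm (par : seq R) (Om : set input)
    (Gam : input -> set H) (Lam : input -> set evaluation) : Prop :=
  general_algorithm Om Gam Lam /\
  exists p : tree, forall x, Om x -> computes par x (Lam x) p (Gam x).

(* The problem of computing Xi, with values in the space MM with metric d, from
   the inputs in Om, with known real parameters par, belongs to Delta_1. *)
Definition Delta1 (par : seq R) (Om : set input) (MM : set (set H))
    (d : set H -> set H -> R) (Xi : input -> set H) : Prop :=
  exists (Gam : nat -> input -> set H)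
         (Lam : nat -> input -> set evaluation),
    forall n,
      radical_algorithm par Om (Gam n) (Lam n) /\
      forall x, Om x -> MM (Gam n x) /\ d (Gam n x) (Xi x) <= 2 ^- n.

End Algorithms.

(* Main.v *)
From mathcomp Require Import all_boot all_order all_algebra.
From mathcomp Require Import complex ring lra.
From mathcomp Require Import all_classical all_reals all_analysis.
Require Import Defs.

Set Implicit Arguments.
Unset Strict Implicit.
Unset Printing Implicit Defensive.

Import Order.TTheory GRing.Theory Num.Theory.
Import numFieldNormedType.Exports complex.ComplexField.Normc.

Local Open Scope classical_set_scope.
Local Open Scope ring_scope.

(* Let E = span(e_1, ..., e_M).  If A solves the Sylvester equation, the map
   q v = P v - A v satisfies q T = T q, and its kernel is the orthogonal
   complement of S, with |q v| >= |proj_S v|.  Hence |q (T^k v)| >= alpha^k |q v|,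
   while the component of T^k v off ran P is at most beta^k |v - P v|, and
   |A| <= |P T (I - P)| / (alpha - beta); so on the class the gap between T^k E
   and ran P is at most L t^k, for a k known in advance.

   For fixed k the vectors T^k e_j depend continuously on finitely many
   evaluations: the values of g control the tails of the columns of T, and
   |T| <= L.  So every input has a ball of evaluations, with rational data, on
   which one rational subspace is a correct answer.  There are countably many
   such pairs, and the algorithm tries them one after the other. *)

(** * The inner product of l^2 *)

(** For non-normal [T] the block P T (I - P) feeds the complement back into ran P, so |P T^k v| has
    no direct lower bound; q replaces P because it removes this coupling, at the price of a factor 1
    + |A|. The quotient in the class is then natural: for v in E, |v - P v| is at most |v| times the
    sine of the angle to ran P, and |q v| is at least |v| times the cosine of the angle to S.
    Dividing the upper bound for (I - P) T^k v by the lower bound for T^k v leaves (beta / alpha)^k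
    times what the class bounds by L. Such a one-sided estimate becomes a bound on [delta_hat]
    because the two dimensions agree.

    No modulus of continuity is available uniformly over the class: how many entries of a column
    matter is dictated by g on the given input. Searching avoids such a modulus, and stopping at the
    first success makes the set of evaluations read depend on those evaluations alone, as a general
    algorithm demands. *)

Section InnerProduct.
Variable R : realType.
Local Notation H := (ell2 R).
Implicit Types (x y z : H) (a : R[i]).

Let re x y : R^nat := fun k => complex.Re (x k * (y k)^*).
Let im x y : R^nat := fun k => complex.Im (x k * (y k)^*).

Lemma sqmod_summable x : cvgn (series (fun k => sqmod (x k))).
Proof. by case: x => u /= /asboolP. Qed.

Lemma re_conjM (z w : R[i]) :
  complex.Re (z * w^*) = complex.Re z * complex.Re w + complex.Im z * complex.Im w.
Proof. by case: z w => [a b] [c d] /=; ring. Qed.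

Lemma im_conjM (z w : R[i]) :
  complex.Im (z * w^*) = complex.Im z * complex.Re w - complex.Re z * complex.Im w.
Proof. by case: z w => [a b] [c d] /=; ring. Qed.

(** Comparison with |x_k|^2 + |y_k|^2. Without convergence the [limn] in [dot] would be a default
    value. *)
Lemma dot_cvg x y : cvgn (series (re x y)) /\ cvgn (series (im x y)).
Proof.
have h (f : R^nat) : (forall k, `|f k| <= sqmod (x k) + sqmod (y k)) ->
    cvgn (series f).
  move=> fle; apply: normed_cvg.
  apply: (@series_le_cvg _ _
    ((fun k => sqmod (x k)) + (fun k => sqmod (y k)))).
  - by move=> n; exact: normr_ge0.
  - by move=> n; apply: addr_ge0; apply: sqmod_ge0.
  - exact: fle.
  - by apply: is_cvg_seriesD; exact: sqmod_summable.
have am (a b c d : R) : `|a * c + b * d| <= a ^+ 2 + b ^+ 2 + (c ^+ 2 + d ^+ 2).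
  have := (sqr_ge0 (a + c), sqr_ge0 (a - c), sqr_ge0 (b + d), sqr_ge0 (b - d)).
  have := (sqr_ge0 a, sqr_ge0 b, sqr_ge0 c, sqr_ge0 d).
  by rewrite ler_norml => -[[[? ?] ?] ?] [[[? ?] ?] ?]; apply/andP; split; nra.
split; apply: h => k; rewrite /re /im ?re_conjM ?im_conjM; first exact: am.
rewrite (_ : _ - _ = complex.Im (x k) * complex.Re (y k) +
  complex.Re (x k) * - complex.Im (y k)); last by ring.
by rewrite /sqmod -(sqrrN (complex.Im (y k))) [X in _ <= X + _]addrC; exact: am.
Qed.

Lemma ell2D x y k : (x + y) k = x k + y k. Proof. by []. Qed.

Lemma ell2Z a x k : (a *: x) k = a * x k. Proof. by []. Qed.

Lemma dotZDl a x y z : dot (a *: x + y) z = a * dot x z + dot y z.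
Proof.
have [rx ix] := dot_cvg x z; have [ry iy] := dot_cvg y z.
have e1 : re (a *: x + y) z =
    complex.Re a *: re x z + (- complex.Im a) *: im x z + re y z.
  apply/funext => k; rewrite /re /im !fctE !re_conjM !im_conjM ell2D ell2Z /GRing.scale/=.
  by case: a (x k) (y k) (z k) => [? ?] [? ?] [? ?] [? ?] /=; ring.
have e2 : im (a *: x + y) z =
    complex.Re a *: im x z + complex.Im a *: re x z + im y z.
  apply/funext => k; rewrite /re /im !fctE !re_conjM !im_conjM ell2D ell2Z /GRing.scale/=.
  by case: a {e1} (x k) (y k) (z k) => [? ?] [? ?] [? ?] [? ?] /=; ring.
have lin (f g h : R^nat) (c d : R) : cvgn (series f) -> cvgn (series g) ->
    cvgn (series h) -> limn (series (c *: f + d *: g + h)) =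
    c * limn (series f) + d * limn (series g) + limn (series h).
  move=> fc gc hc; have cfc : cvgn (series (c *: f)) by exact: is_cvg_seriesZ.
  have dgc : cvgn (series (d *: g)) by exact: is_cvg_seriesZ.
  have cdc := is_cvg_seriesD cfc dgc.
  by rewrite (lim_seriesD cdc hc) (lim_seriesD cfc dgc) !lim_seriesZ.
rewrite /dot -/(re (a *: x + y) z) -/(im (a *: x + y) z) e1 e2 !lin//.
rewrite -/(re x z) -/(im x z) -/(re y z) -/(im y z).
by case: a {e1 e2} => a b; apply/eqP; rewrite eq_complex /= mulNr !eqxx.
Qed.

Lemma dotC x y : dot y x = (dot x y)^*.
Proof.
have [rx ix] := dot_cvg x y.
have e1 : re y x = re x y by apply/funext => k; rewrite /re !re_conjM; ring.
have e2 : im y x = - im x y.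
  by apply/funext => k; rewrite /im fctE !im_conjM; ring.
by rewrite /dot -/(re y x) -/(im y x) e1 e2 lim_seriesN.
Qed.

Lemma dotDl x y z : dot (x + y) z = dot x z + dot y z.
Proof. by rewrite -[x in LHS]scale1r dotZDl mul1r. Qed.

Lemma dot0l y : dot 0 y = 0.
Proof. by apply: (addrI (dot 0 y)); rewrite -dotDl !addr0. Qed.

Lemma dotZl a x y : dot (a *: x) y = a * dot x y.
Proof. by rewrite -[a *: x]addr0 dotZDl dot0l addr0. Qed.

Lemma dotNl x y : dot (- x) y = - dot x y.
Proof. by rewrite -scaleN1r dotZl mulN1r. Qed.

Lemma dotBl x y z : dot (x - y) z = dot x z - dot y z.
Proof. by rewrite dotDl dotNl. Qed.

Lemma dot_suml n (v : 'I_n -> H) y : dot (\sum_i v i) y = \sum_i dot (v i) y.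
Proof. by apply: (big_morph (fun x => dot x y)); [move=> *; rewrite dotDl | rewrite dot0l]. Qed.

Lemma dotDr x y z : dot x (y + z) = dot x y + dot x z.
Proof. by rewrite dotC dotDl rmorphD (dotC y x) (dotC z x). Qed.

Lemma dot0r x : dot x 0 = 0.
Proof. by rewrite dotC dot0l rmorph0. Qed.

Lemma dotZr a x y : dot x (a *: y) = a^* * dot x y.
Proof. by rewrite dotC dotZl rmorphM (dotC y x). Qed.

Lemma dotNr x y : dot x (- y) = - dot x y.
Proof. by rewrite dotC dotNl rmorphN (dotC y x). Qed.

Lemma dotBr x y z : dot x (y - z) = dot x y - dot x z.
Proof. by rewrite dotDr dotNr. Qed.

Lemma dot_sumr n (v : 'I_n -> H) y : dot y (\sum_i v i) = \sum_i dot y (v i).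
Proof. by apply: (big_morph (dot y)); [move=> *; rewrite dotDr | rewrite dot0r]. Qed.

Lemma Re_dotxx x : complex.Re (dot x x) = limn (series (fun k => sqmod (x k))).
Proof.
congr (limn (series _)); apply/funext => k.
by rewrite re_conjM /sqmod !expr2.
Qed.

Lemma series_sqmod_le x n : series (fun k => sqmod (x k)) n <= complex.Re (dot x x).
Proof.
rewrite Re_dotxx; apply: (nondecreasing_cvgn_le _ (@sqmod_summable x) n).
by apply/nondecreasing_seqP => k; rewrite seriesSr lerDl sqmod_ge0.
Qed.

Lemma l2norm_ge0 x : 0 <= l2norm x. Proof. exact: sqrtr_ge0. Qed.

Lemma l2norm_sq x : l2norm x ^+ 2 = complex.Re (dot x x).
Proof.
apply: sqr_sqrtr; apply: le_trans (series_sqmod_le x 0).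
by rewrite /series/= big_geq.
Qed.

Lemma dotxx x : dot x x = (l2norm x ^+ 2)%:C%C.
Proof.
have := dotC x x; rewrite l2norm_sq; case: (dot x x) => a b [hb].
by apply/eqP; rewrite eq_complex /= eqxx; apply/eqP; lra.
Qed.

Lemma sqmod_le x k : sqmod (x k) <= l2norm x ^+ 2.
Proof.
rewrite l2norm_sq; apply: le_trans (series_sqmod_le x k.+1).
rewrite seriesSr lerDr; apply: sumr_ge0 => i _; exact: sqmod_ge0.
Qed.

Lemma sqmod_eq0 (z : R[i]) : sqmod z <= 0 -> z = 0.
Proof.
case: z => a b; rewrite /sqmod /= => h; apply/eqP; rewrite eq_complex /=.
have := (sqr_ge0 a, sqr_ge0 b) => -[ha hb].
by rewrite -(sqrf_eq0 a) -(sqrf_eq0 b); apply/andP; split; apply/eqP; lra.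
Qed.

Lemma l2norm0_eq0 x : l2norm x = 0 -> x = 0.
Proof.
move=> x0; apply: val_inj; apply/funext => k; apply: sqmod_eq0.
by apply: le_trans (sqmod_le x k) _; rewrite x0 expr0n.
Qed.

Lemma dotxx_eq0 x : dot x x = 0 -> x = 0.
Proof.
by rewrite dotxx => -[/eqP]; rewrite sqrf_eq0 => /eqP/l2norm0_eq0.
Qed.

Lemma dot_eq x y : (forall z, dot z x = dot z y) -> x = y.
Proof.
move=> h; apply/eqP; rewrite -subr_eq0; apply/eqP/dotxx_eq0.
by rewrite dotBr h subrr.
Qed.

Lemma l2norm0 : l2norm (0 : H) = 0.
Proof. by rewrite /l2norm dot0l sqrtr0. Qed.

Lemma dotxE x j : dot x (e_ R j) = x j.
Proof.
have h (f : R^nat) (a : R) : (forall k, f k = if k == j then a else 0) -> limn (series f) = a.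
  move=> fE; apply/cvg_lim => //; apply: cvg_near_cst; near=> n.
  have jn : (j < n)%N by near: n; exact: nbhs_infty_gt.
  rewrite /series /= (bigD1_seq j) ?mem_index_iota ?iota_uniq//= big1 => [|i ij].
    by rewrite fE eqxx addr0.
  by rewrite fE (negbTE ij).
rewrite [RHS](_ : _ = Complex (complex.Re (x j)) (complex.Im (x j))); last by case: (x j).
by congr Complex; apply: h => k; rewrite /= /delta_seq; case: eqP => [->|_]; rewrite ?rmorph1 ?rmorph0 ?mulr1 ?mulr0.
Unshelve. all: by end_near. Qed.

Lemma l2norm_sqZ a x : l2norm (a *: x) ^+ 2 = sqmod a * l2norm x ^+ 2.
Proof.
rewrite !l2norm_sq dotZl dotZr dotxx; case: a => a b; rewrite /sqmod /=; ring.
Qed.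

Lemma normc_ge0 a : 0 <= normc a.
Proof. by case: a => ? ?; exact: sqrtr_ge0. Qed.

Lemma normc_sq a : normc a ^+ 2 = sqmod a.
Proof. by case: a => a b; rewrite /sqmod /= sqr_sqrtr// addr_ge0 ?sqr_ge0. Qed.

Lemma l2normZ a x : l2norm (a *: x) = normc a * l2norm x.
Proof.
apply/eqP; rewrite -(@eqrXn2 _ 2)// ?mulr_ge0 ?l2norm_ge0 ?normc_ge0//.
by rewrite l2norm_sqZ exprMn normc_sq.
Qed.

Lemma l2norm_sqD x y :
  l2norm (x + y) ^+ 2 = l2norm x ^+ 2 + l2norm y ^+ 2 + 2 * complex.Re (dot x y).
Proof.
rewrite !l2norm_sq dotDl !dotDr (dotC x y).
case: (dot x x) (dot x y) (dot y y) => [? ?] [? ?] [? ?] /=; ring.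
Qed.

Lemma sqmod_dot_le x y : sqmod (dot x y) <= l2norm x ^+ 2 * l2norm y ^+ 2.
Proof.
have [y0|y0] := eqVneq (l2norm y) 0.
  by rewrite (l2norm0_eq0 y0) dot0r l2norm0 /sqmod /= !expr0n/= mulr0 addr0.
have yp : 0 < l2norm y ^+ 2 by rewrite exprn_gt0// lt_neqAle eq_sym y0 l2norm_ge0.
have quad a b : 0 <= sqmod a * l2norm x ^+ 2 + sqmod b * l2norm y ^+ 2 +
    2 * complex.Re (a * (b^* * dot x y)).
  rewrite -dotZr -dotZl -(l2norm_sqZ a x) -(l2norm_sqZ b y) -l2norm_sqD.
  exact: sqr_ge0.
(* For a = |y|^2 and b = - <x, y> the square |a x + b y|^2 equals |y|^2 times the difference of the
   two sides. *)
move: (quad (l2norm y ^+ 2)%:C%C (- dot x y)) => {quad}.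
move: yp; set c := l2norm y ^+ 2; set b := l2norm x ^+ 2.
case: (dot x y) => u v /=; rewrite /sqmod /= => yp h.
rewrite -(ler_pM2l yp) -subr_ge0; apply: le_trans h _.
by rewrite le_eqVlt; apply/orP; left; apply/eqP; ring.
Qed.

Lemma normc_dot_le x y : normc (dot x y) <= l2norm x * l2norm y.
Proof.
rewrite -(@ler_pXn2r _ 2)// ?nnegrE ?mulr_ge0 ?l2norm_ge0 ?normc_ge0//.
by rewrite exprMn normc_sq sqmod_dot_le.
Qed.

Lemma Re_le_normc (z : R[i]) : complex.Re z <= normc z.
Proof.
case: z => a b /=; apply: le_trans (ler_norm _) _.
by rewrite -sqrtr_sqr ler_sqrt ?addr_ge0 ?sqr_ge0// lerDl sqr_ge0.
Qed.

Lemma ler_l2normD x y : l2norm (x + y) <= l2norm x + l2norm y.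
Proof.
rewrite -(@ler_pXn2r _ 2)// ?nnegrE ?addr_ge0 ?l2norm_ge0//.
rewrite l2norm_sqD; have := le_trans (Re_le_normc _) (normc_dot_le x y).
rewrite sqrrD; lra.
Qed.

Lemma l2normN x : l2norm (- x) = l2norm x.
Proof. by rewrite /l2norm dotNl dotNr opprK. Qed.

Lemma l2normB x y : l2norm (x - y) = l2norm (y - x).
Proof. by rewrite -l2normN opprB. Qed.

Lemma l2norm_e j : l2norm (e_ R j) = 1.
Proof. by rewrite /l2norm dotxE /= /delta_seq eqxx /= sqrtr1. Qed.

Lemma ler_l2norm_sum n (v : 'I_n -> H) :
  l2norm (\sum_i v i) <= \sum_i l2norm (v i).
Proof.
elim/big_ind2 : _ => //; first by rewrite l2norm0.
by move=> x a y b xa yb; apply: le_trans (ler_l2normD _ _) (lerD xa yb).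
Qed.

End InnerProduct.

(** * Bounded operators and orthogonal projections *)

Section LinearMaps.
Variables (F : pzRingType) (U V : lmodType F) (f : U -> V).
Hypothesis lf : linear f.

Lemma linearmapD x y : f (x + y) = f x + f y.
Proof. by rewrite -[x in LHS]scale1r lf scale1r. Qed.

Lemma linearmap0 : f 0 = 0.
Proof. by apply: (addrI (f 0)); rewrite -linearmapD !addr0. Qed.

Lemma linearmapZ a x : f (a *: x) = a *: f x.
Proof. by rewrite -[a *: x]addr0 lf linearmap0 addr0. Qed.

Lemma linearmapN x : f (- x) = - f x.
Proof. by rewrite -scaleN1r linearmapZ scaleN1r. Qed.

Lemma linearmapB x y : f (x - y) = f x - f y.
Proof. by rewrite linearmapD linearmapN. Qed.

Lemma linearmap_sum n (v : 'I_n -> U) : f (\sum_i v i) = \sum_i f (v i).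
Proof. by apply: (big_morph f linearmapD linearmap0). Qed.

Lemma linearmap_comb n (c : 'I_n -> F) (v : 'I_n -> U) :
  f (\sum_i c i *: v i) = \sum_i c i *: f (v i).
Proof. by rewrite linearmap_sum; apply: eq_bigr => i _; rewrite linearmapZ. Qed.

End LinearMaps.

Lemma linear_comp (F : pzRingType) (U V W : lmodType F) (f : V -> W) (g : U -> V) :
  linear f -> linear g -> linear (f \o g).
Proof. by move=> lf lg a x y /=; rewrite lg lf. Qed.

Lemma linear_sub (F : comPzRingType) (U V : lmodType F) (f g : U -> V) :
  linear f -> linear g -> linear (fun x => f x - g x).
Proof. by move=> lf lg a x y; rewrite lf lg scalerBr opprD addrACA. Qed.

Section Bounded.
Variable R : realType.
Local Notation H := (ell2 R).
Implicit Types (x y z : H) (a : R[i]) (f g T P : H -> H).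

Lemma bounded_comp f g : bounded_op f -> bounded_op g -> bounded_op (f \o g).
Proof.
move=> [lf [C fC]] [lg [D gD]]; split; first exact: linear_comp.
exists (`|C| * D) => x /=; apply: le_trans (fC _) _.
apply: le_trans (ler_wpM2r (l2norm_ge0 _) (ler_norm C)) _.
by rewrite -mulrA; apply: ler_wpM2l.
Qed.

Lemma bounded_sub f g : bounded_op f -> bounded_op g -> bounded_op (fun x => f x - g x).
Proof.
move=> [lf [C fC]] [lg [D gD]]; split; first exact: linear_sub.
exists (C + D) => x; apply: le_trans (ler_l2normD _ _) _.
by rewrite l2normN mulrDl lerD.
Qed.

Lemma bounded_id : bounded_op (@id H).
Proof. by split=> //; exists 1 => x; rewrite mul1r. Qed.

Lemma opnorm_has_sup f : bounded_op f ->
  has_sup [set l2norm (f x) | x in [set x | l2norm x <= 1]].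
Proof.
move=> [lf [C fC]]; split.
  by exists (l2norm (f 0)), 0 => //=; rewrite l2norm0.
exists `|C| => _ [x /= x1 <-]; apply: le_trans (fC x) _.
apply: le_trans (ler_wpM2r (l2norm_ge0 _) (ler_norm C)) _.
by rewrite -[leRHS]mulr1; apply: ler_wpM2l.
Qed.

Lemma opnorm_ge0 f : bounded_op f -> 0 <= opnorm f.
Proof.
move=> bf; have [lf _] := bf; apply: sup_upper_bound; first exact: opnorm_has_sup.
by exists 0 => /=; rewrite ?l2norm0// (linearmap0 lf) l2norm0.
Qed.

Lemma opnormP f x : bounded_op f -> l2norm (f x) <= opnorm f * l2norm x.
Proof.
move=> bf; have [lf _] := bf; have [x0|x0] := eqVneq (l2norm x) 0.
  by rewrite (l2norm0_eq0 x0) (linearmap0 lf) l2norm0 mulr0.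
have xp : 0 < l2norm x by rewrite lt_neqAle eq_sym x0 l2norm_ge0.
have nV : normc ((l2norm x)^-1)%:C%C = (l2norm x)^-1.
  by rewrite /= expr0n addr0 sqrtr_sqr gtr0_norm// invr_gt0.
suff : l2norm (f ((l2norm x)^-1%:C%C *: x)) <= opnorm f.
  by rewrite (linearmapZ lf) l2normZ nV ler_pdivrMl// mulrC.
apply: sup_upper_bound; first exact: opnorm_has_sup.
by exists ((l2norm x)^-1%:C%C *: x) => //=; rewrite l2normZ nV mulVf.
Qed.

Lemma opnorm_le f r : 0 <= r -> (forall x, l2norm (f x) <= r * l2norm x) ->
  opnorm f <= r.
Proof.
move=> r0 fr; apply: ge_sup; first by exists (l2norm (f 0)), 0; rewrite /= ?l2norm0.
move=> _ [x /= x1 <-]; apply: le_trans (fr x) _.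
by rewrite -[leRHS]mulr1; apply: ler_wpM2l.
Qed.

Section Projection.
Variable P : H -> H.
Hypothesis oP : orthogonal_projection P.
Let lP : linear P. Proof. by case: oP. Qed.
Let PP x : P (P x) = P x. Proof. by case: oP. Qed.
Let sP x y : dot (P x) y = dot x (P y). Proof. by case: oP. Qed.

Lemma proj_rangeP x : range P x <-> P x = x.
Proof. by split=> [[y _ <-]|Px]; [exact: PP | exists x]. Qed.

Lemma proj_orth x y : dot (P x) (y - P y) = 0.
Proof. by rewrite sP (linearmapB lP) PP subrr dot0r. Qed.

Lemma proj_pythagoras x : l2norm x ^+ 2 = l2norm (P x) ^+ 2 + l2norm (x - P x) ^+ 2.
Proof. by have := l2norm_sqD (P x) (x - P x); rewrite subrKC proj_orth mulr0 addr0. Qed.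

Lemma proj_le x : l2norm (P x) <= l2norm x.
Proof.
rewrite -(@ler_pXn2r _ 2)// ?nnegrE ?l2norm_ge0//.
by rewrite (proj_pythagoras x) lerDl sqr_ge0.
Qed.

Lemma projC_le x : l2norm (x - P x) <= l2norm x.
Proof.
rewrite -(@ler_pXn2r _ 2)// ?nnegrE ?l2norm_ge0//.
by rewrite (proj_pythagoras x) lerDr sqr_ge0.
Qed.

Lemma bounded_proj : bounded_op P.
Proof. by split=> //; exists 1 => x; rewrite mul1r proj_le. Qed.

Lemma bounded_projC : bounded_op (fun x => x - P x).
Proof. exact: bounded_sub bounded_id bounded_proj. Qed.

End Projection.

Lemma oproj_unique P Q : orthogonal_projection P -> orthogonal_projection Q ->
  range P = range Q -> P = Q.
Proof.
move=> oP oQ PQ; apply/funext => x.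
have QP y : Q (P y) = P y by apply/(proj_rangeP oQ); rewrite -PQ; exists y.
have PQ' y : P (Q y) = Q y by apply/(proj_rangeP oP); rewrite PQ; exists y.
have [_ _ sP] := oP; have [_ _ sQ] := oQ.
by apply: dot_eq => z; rewrite -sP -QP sQ sP PQ'.
Qed.

Lemma oprojE P : orthogonal_projection P -> oproj (range P) = P.
Proof.
move=> oP; rewrite /oproj.
have [|oE rE] := xgetPex (fun=> 0) (_ : exists E, [set E | orthogonal_projection E /\ range E = range P] E).
  by exists P.
exact: oproj_unique.
Qed.

End Bounded.

(** * Gram matrices and projections onto finite-dimensional subspaces *)

Section Gram.
Variables (R : realType) (n : nat) (v : 'I_n -> ell2 R).
Local Notation H := (ell2 R).
Hypothesis iv : lin_indep v.

Let gram : 'M[R[i]]_n := \matrix_(i, j) dot (v i) (v j).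

(** A row c in the left kernel gives a vector sum c_i v_i orthogonal to every v_j, hence to
    itself. *)
Lemma gram_unit : gram \in unitmx.
Proof.
rewrite -row_free_unit; apply: inj_row_free => c cG.
pose x : H := \sum_i c 0 i *: v i.
have xv j : dot x (v j) = 0.
  have /matrixP/(_ 0 j) := cG; rewrite !mxE => <-; rewrite dot_suml.
  by apply: eq_bigr => i _; rewrite dotZl mxE.
have /iv c0 : x = 0.
  apply: dotxx_eq0.
  by rewrite {2}/x dot_sumr big1// => i _; rewrite dotZr xv mulr0.
by apply/rowP => i; rewrite c0 mxE.
Qed.

(** Solution of the normal equations c G = (<x, v_j>)_j, G being the Gram matrix. *)
Let coord x : 'rV[R[i]]_n := (\row_j dot x (v j)) *m invmx gram.
Let proj x : H := \sum_i coord x 0 i *: v i.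

Let proj_orthv x j : dot (proj x) (v j) = dot x (v j).
Proof.
transitivity ((coord x *m gram) 0 j).
  by rewrite [RHS]mxE dot_suml; apply: eq_bigr => i _; rewrite dotZl [gram _ _]mxE.
by rewrite mulmxKV ?gram_unit// mxE.
Qed.

Let coord_comb (c : 'I_n -> R[i]) i : coord (\sum_j c j *: v j) 0 i = c i.
Proof.
rewrite /coord (_ : \row_j _ = (\row_j c j) *m gram); last first.
  apply/rowP => j; rewrite !mxE dot_suml; apply: eq_bigr => k _.
  by rewrite dotZl !mxE.
by rewrite mulmxK ?gram_unit// mxE.
Qed.

Lemma span_projection : exists2 P : H -> H,
  orthogonal_projection P & range P = span v.
Proof.
have proj_span c : proj (\sum_j c j *: v j) = \sum_j c j *: v j.
  by apply: eq_bigr => i _; rewrite coord_comb.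
have projo x y : dot (proj x) (y - proj y) = 0.
  rewrite {1}/proj dot_suml big1// => i _.
  by rewrite dotZl dotC dotBl proj_orthv subrr rmorph0 mulr0.
exists proj.
  split.
  - move=> a x y; rewrite /proj /coord scaler_sumr -big_split/=; apply: eq_bigr => i _.
    rewrite (_ : \row_j _ = a *: (\row_j dot x (v j)) + \row_j dot y (v j)).
      by rewrite mulmxDl -scalemxAl 2!mxE scalerDl scalerA.
    by apply/rowP => j; rewrite !mxE dotZDl.
  - by move=> x; exact: proj_span.
  - have h x y : dot (proj x) y = dot (proj x) (proj y).
      by apply/eqP; rewrite -subr_eq0 -dotBr projo.
    by move=> x y; rewrite (h x y) (dotC (proj y) x) (h y x); exact: dotC.
apply/seteqP; split=> [_ [x _ <-]|_ [c ->]].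
  by exists (fun i => coord x 0 i).
by exists (\sum_i c i *: v i) => //; exact: proj_span.
Qed.

Lemma lin_indep_bound : exists2 K : R, 0 < K &
  forall c : 'I_n -> R[i],
    \sum_i normc (c i) <= K * l2norm (\sum_i c i *: v i).
Proof.
pose K0 : R := \sum_i \sum_j l2norm (v j) * normc (invmx gram j i).
have K0p : 0 <= K0.
  by do 2!apply: sumr_ge0 => ? _; rewrite mulr_ge0 ?l2norm_ge0 ?normc_ge0.
(* [K0] vanishes when n = 0; adding 1 keeps the constant positive. *)
exists (K0 + 1) => [|c]; first by rewrite ltr_wpDl.
set x := \sum_i c i *: v i.
apply: (@le_trans _ _ (K0 * l2norm x)); last first.
  by rewrite ler_wpM2r ?l2norm_ge0// lerDl.
rewrite /K0 mulr_suml; apply: ler_sum => i _.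
rewrite -(coord_comb c i) -/x /coord mxE mulr_suml.
apply: (@le_trans _ _ (\sum_j normc ((\row_j dot x (v j)) 0 j * invmx gram j i))).
  elim/big_ind2 : _ => //; first by rewrite normc0.
  by move=> a b a' b' h h'; apply: le_trans (le_normcD _ _) (lerD h h').
apply: ler_sum => j _; rewrite mxE normcM mulrAC.
by rewrite ler_wpM2r ?normc_ge0// mulrC normc_dot_le.
Qed.

End Gram.

(** * The gap between subspaces of equal dimension *)

Section Gap.
Variable R : realType.
Local Notation H := (ell2 R).
Implicit Types (x y z : H) (V W : set H).

(** Dimension count: both families have n members, so q is described by a square matrix; injectivity
    kills its left kernel, and the inverse matrix supplies preimages. *)
Lemma span_surj n (v s : 'I_n -> H) (q : H -> H) :
  lin_indep v -> linear q ->
  (forall x, span v x -> span s (q x)) ->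
  (forall x, span v x -> q x = 0 -> x = 0) ->
  forall y, span s y -> exists2 x, span v x & q x = y.
Proof.
move=> iv lq qs q0.
have spanv i : span v (v i).
  exists (fun j => (j == i)%:R); rewrite (bigD1 i)//= eqxx scale1r big1 ?addr0// => j ji.
  by rewrite (negbTE ji) scale0r.
have /choice[C hC] i : exists c : 'I_n -> R[i], q (v i) = \sum_j c j *: s j.
  exact: qs.
pose A : 'M[R[i]]_n := \matrix_(i, j) C i j.
have qA (c : 'rV[R[i]]_n) : q (\sum_i c 0 i *: v i) = \sum_j (c *m A) 0 j *: s j.
  rewrite (linearmap_comb lq); under eq_bigr do rewrite hC scaler_sumr.
  rewrite exchange_big; apply: eq_bigr => j _ /=; rewrite mxE scaler_suml.
  by apply: eq_bigr => i _; rewrite scalerA mxE.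
have Au : A \in unitmx.
  rewrite -row_free_unit; apply: inj_row_free => c cA.
  have : q (\sum_i c 0 i *: v i) = 0.
    by rewrite qA cA big1// => j _; rewrite mxE scale0r.
  move=> /q0 h; have /h/iv c0 : span v (\sum_i c 0 i *: v i) by exists (c 0).
  by apply/rowP => i; rewrite c0 mxE.
move=> _ [d ->]; pose c := (\row_j d j) *m invmx A.
exists (\sum_i c 0 i *: v i); first by exists (c 0).
by rewrite qA mulmxKV//; apply: eq_bigr => j _; rewrite mxE.
Qed.

Section TwoProjections.
Variables P Q : H -> H.
Hypotheses (oP : orthogonal_projection P) (oQ : orthogonal_projection Q).

(** P x - Q x is P (x - Q x) minus (I - P) Q x, an orthogonal decomposition. It reduces the norm of
    P - Q to P on ker Q and I - P on ran Q. *)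
Lemma proj_sub_sq x : l2norm (P x - Q x) ^+ 2 =
  l2norm (P (x - Q x)) ^+ 2 + l2norm (Q x - P (Q x)) ^+ 2.
Proof.
have [lP _ _] := oP.
have -> : P x - Q x = P (x - Q x) + - (Q x - P (Q x)).
  by rewrite (linearmapB lP) opprB addrA subrK.
by rewrite l2norm_sqD l2normN dotNr (proj_orth oP) oppr0 mulr0 addr0.
Qed.

Lemma proj_sub_le1 x : l2norm (P x - Q x) <= l2norm x.
Proof.
rewrite -(@ler_pXn2r _ 2)// ?nnegrE ?l2norm_ge0// proj_sub_sq.
rewrite (proj_pythagoras oQ x) addrC; apply: lerD.
  by rewrite ler_pXn2r// ?nnegrE ?l2norm_ge0// (projC_le oP).
by rewrite ler_pXn2r// ?nnegrE ?l2norm_ge0// (proj_le oP).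
Qed.

(* For s = Q y with y in ran P, <P s, y> = |s|^2, so a lower bound for Q on ran P
   is also one for P on ran Q. *)
Lemma proj_gap (r : R) : 0 <= r < 1 ->
  (forall y, range P y -> l2norm (y - Q y) <= r * l2norm y) ->
  (forall s, range Q s -> exists2 y, range P y & Q y = s) ->
  opnorm (fun x => P x - Q x) <= r.
Proof.
move=> /andP[r0 r1] PQr Qsurj; have [lP PP sP] := oP; have [lQ QQ sQ] := oQ.
(* The part on ker Q: |P w|^2 = <P w, w> = <P w - Q (P w), w>, and P w lies in ran P, where I - Q is
   at most r. *)
have aux1 w : Q w = 0 -> l2norm (P w) ^+ 2 <= r ^+ 2 * l2norm w ^+ 2.
  move=> Qw; have : l2norm (P w) ^+ 2 <= (r * l2norm (P w)) * l2norm w.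
    rewrite l2norm_sq sP PP dotC.
    have -> : dot (P w) w = dot (P w - Q (P w)) w.
      by rewrite dotBl sQ Qw dot0r subr0.
    have -> (z : R[i]) : complex.Re z^* = complex.Re z by case: z.
    apply: le_trans (Re_le_normc _) _; apply: le_trans (normc_dot_le _ _) _.
    by rewrite ler_wpM2r ?l2norm_ge0// PQr//; exists w.
  rewrite -exprMn; have := l2norm_ge0 (P w); have := l2norm_ge0 w.
  move: (l2norm (P w)) (l2norm w) => a b b0 a0; rewrite [leLHS]expr2 mulrAC.
  have [->|an0] := eqVneq a 0; first by rewrite expr0n/= sqr_ge0.
  rewrite ler_pM2r ?lt_neqAle 1?eq_sym ?an0// => ab.
  by rewrite ler_pXn2r ?nnegrE// mulr_ge0.
have aux2 s : Q s = s -> l2norm (s - P s) ^+ 2 <= r ^+ 2 * l2norm s ^+ 2.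
  move=> Qs; have [|v Pv Qv] := Qsurj s; first by exists s.
  have hv := PQr v Pv; have := proj_pythagoras oQ v; rewrite Qv => hvs.
  have hv2 : l2norm (v - s) ^+ 2 <= r ^+ 2 * l2norm v ^+ 2.
    by rewrite -exprMn -Qv ler_pXn2r ?nnegrE ?mulr_ge0 ?l2norm_ge0.
  have h4 : l2norm s ^+ 2 <= l2norm (P s) * l2norm v.
    rewrite l2norm_sq -{2}Qv -sQ Qs.
    have /(proj_rangeP oP) Pvv := Pv; rewrite -{1}Pvv -sP.
    exact: le_trans (Re_le_normc _) (normc_dot_le _ _).
  have := proj_pythagoras oP s.
  have := l2norm_ge0 (P s); have := l2norm_ge0 v; have := l2norm_ge0 s.
  move: h4 hvs hv2; move: (l2norm s) (l2norm v) (l2norm (P s)) => a b c h4.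
  move: (l2norm (s - P s) ^+ 2) (l2norm (v - s) ^+ 2) => d e h1 h2 a0 b0 c0 h5.
  have r2 : 0 <= r ^+ 2 < 1 by rewrite sqr_ge0 expr_lt1.
  have h6 : (1 - r ^+ 2) * b ^+ 2 <= a ^+ 2 by nra.
  have h7 : a ^+ 2 * a ^+ 2 <= c ^+ 2 * b ^+ 2.
    by rewrite -expr2 -exprMn ler_pXn2r ?nnegrE ?sqr_ge0 ?mulr_ge0.
  suff : (1 - r ^+ 2) * a ^+ 2 <= c ^+ 2 by lra.
  have [->|an0] := eqVneq a 0; first by rewrite expr0n/= mulr0 sqr_ge0.
  have ap : 0 < a ^+ 2 by rewrite exprn_gt0// lt_neqAle eq_sym an0.
  rewrite -(ler_pM2r ap); apply: le_trans (_ : (1 - r ^+ 2) * (c ^+ 2 * b ^+ 2) <= _).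
    by rewrite -mulrA ler_wpM2l//; lra.
  by rewrite mulrCA ler_wpM2l ?sqr_ge0.
apply: opnorm_le => // x; rewrite -(@ler_pXn2r _ 2)// ?nnegrE ?mulr_ge0 ?l2norm_ge0//.
rewrite proj_sub_sq exprMn (proj_pythagoras oQ x) mulrDr addrC; apply: lerD.
  exact/aux2/QQ.
by apply: aux1; rewrite (linearmapB lQ) QQ subrr.
Qed.

End TwoProjections.

Lemma has_dim_projection n V : has_dim n V ->
  exists2 P : H -> H, orthogonal_projection P & range P = V.
Proof. by move=> [v [iv ->]]; exact: span_projection. Qed.

Lemma delta_hat_range P Q : orthogonal_projection P -> orthogonal_projection Q ->
  @delta_hat R (range P) (range Q) = opnorm (fun x => P x - Q x).
Proof. by move=> oP oQ; rewrite /delta_hat !oprojE. Qed.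

Lemma delta_hat_itv V P (n : nat) : has_dim n V -> orthogonal_projection P ->
  0 <= delta_hat V (range P) <= 1.
Proof.
move=> /has_dim_projection[Q oQ <-] oP; rewrite delta_hat_range//.
rewrite opnorm_ge0 ?opnorm_le//=.
  by move=> x; rewrite mul1r; exact: proj_sub_le1.
by apply: bounded_sub; exact: bounded_proj.
Qed.

Lemma delta_hat_ub V P (n : nat) x : has_dim n V -> orthogonal_projection P ->
  V x -> l2norm (x - P x) <= delta_hat V (range P) * l2norm x.
Proof.
move=> /has_dim_projection[Q oQ <-] oP; rewrite delta_hat_range//.
move=> /(proj_rangeP oQ) Qx; rewrite -{1}Qx.
apply: (@opnormP _ (fun x => Q x - P x)).
by apply: bounded_sub; exact: bounded_proj.
Qed.

(** Since r < 1, P y = 0 forces y = 0 on V; equal dimensions then make P map V onto ran P, which is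
    the surjectivity [proj_gap] asks for, with P in the role of its Q. *)
Lemma delta_hat_le n V P (r : R) : has_dim n V -> has_dim n (range P) ->
  orthogonal_projection P -> 0 <= r < 1 ->
  (forall y, V y -> l2norm (y - P y) <= r * l2norm y) ->
  delta_hat V (range P) <= r.
Proof.
move=> [v [iv ->]] [s [is_ rPs]] oP r01 vr; have [lP PP _] := oP.
have [Q oQ rQ] := span_projection iv.
rewrite -rQ delta_hat_range//; apply: proj_gap => //; rewrite rQ// rPs.
apply: (span_surj iv lP) => [x _|x vx Px0].
  by rewrite -rPs; exists x.
have := vr x vx; rewrite Px0 subr0 => h; apply: l2norm0_eq0.
have := l2norm_ge0 x; move: h r01 => h /andP[r0 r1]; nra.
Qed.

End Gap.

(** * Convergence of the iterates to the dominant subspace *)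

Section UnitVectors.
Variable R : realType.
Local Notation H := (ell2 R).

Lemma dot_sum_e n (c : nat -> R[i]) j :
  dot (\sum_(i < n) c i *: e_ R i) (e_ R j) = if (j < n)%N then c j else 0.
Proof.
rewrite dot_suml; case: ltnP => jn.
  rewrite (bigD1 (Ordinal jn))//= dotZl dotxE /= /delta_seq eqxx mulr1 big1 ?addr0//.
  move=> i ij; rewrite dotZl dotxE /= /delta_seq (_ : j == i = false) ?mulr0//.
  by apply/negbTE; apply: contra ij => /eqP ji; apply/eqP/val_inj.
rewrite big1// => i _; rewrite dotZl dotxE /= /delta_seq (_ : j == i = false) ?mulr0//.
by apply/negbTE; rewrite neq_ltn (leq_trans (ltn_ord i) jn) orbT.
Qed.

Lemma lin_indep_e n : lin_indep (fun j : 'I_n => e_ R j).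
Proof.
(* Extends the coefficients by zero to all indices, the form [dot_sum_e] expects. *)
move=> c c0 i; pose d k := if insub k is Some j then c j else 0.
have := dot_sum_e n d i; rewrite ltn_ord.
rewrite (eq_bigr (fun i => c i *: e_ R i)) => [|j _]; last by rewrite /d valK.
by rewrite c0 dot0l /d valK.
Qed.

Lemma has_dim_span_e n : has_dim n (@span_e R n).
Proof. by exists (fun j : 'I_n => e_ R j); split => //; exact: lin_indep_e. Qed.

End UnitVectors.

Section Dominant.
Variable R : realType.
Local Notation H := (ell2 R).
Implicit Types (x y z v : H) (T P A : H -> H).

Section Block.
Variables (T P A Astar : H -> H) (alpha beta : R).
Hypotheses (bT : bounded_op T) (oP : orthogonal_projection P).
Hypotheses (invT : forall x, range P x -> range P (T x)).
Hypotheses (beta0 : 0 < beta) (betaalpha : beta < alpha).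
Hypothesis Tge : forall x, range P x -> alpha * l2norm x <= l2norm (T x).
Hypothesis T22le : opnorm (fun x => T (x - P x) - P (T (x - P x))) <= beta.
Hypothesis syl : sylvester_solution T P A.
Hypothesis adjA : adjoint_pair A Astar.

Let bA : bounded_op A. Proof. by case: syl. Qed.
Let lA : linear A. Proof. by case: bA. Qed.
Let lT : linear T. Proof. by case: bT. Qed.
Let lP : linear P. Proof. by case: oP. Qed.
Let PP x : P (P x) = P x. Proof. by case: oP. Qed.
Let sP x y : dot (P x) y = dot x (P y). Proof. by case: oP => _ _; exact. Qed.
Let alpha0 : 0 < alpha. Proof. exact: lt_trans betaalpha. Qed.

Let bC : bounded_op (fun x => x - P x). Proof. exact: bounded_projC. Qed.
Let bTC : bounded_op (fun x => T (x - P x)). Proof. exact: bounded_comp bT bC. Qed.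
Let bT12 : bounded_op (fun x => P (T (x - P x))).
Proof. exact: bounded_comp (bounded_proj oP) bTC. Qed.
Let bT22 : bounded_op (fun x => T (x - P x) - P (T (x - P x))).
Proof. exact: bounded_sub. Qed.

Let AE x : A x = P (A (x - P x)). Proof. by case: syl. Qed.

Let PA x : P (A x) = A x. Proof. by rewrite AE PP. Qed.

Let AP x : A (P x) = 0.
Proof. by rewrite AE PP subrr (linearmap0 lA) (linearmap0 lP). Qed.

Let A0 x : P x = x -> A x = 0. Proof. by move=> <-; rewrite AP. Qed.

Let PT x : P x = x -> P (T x) = T x.
Proof. by move=> Px; apply/(proj_rangeP oP)/invT; exists x. Qed.

Let PC x : P (x - P x) = 0. Proof. by rewrite (linearmapB lP) PP subrr. Qed.

Let q v := P v - A v.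

Let Pq v : P (q v) = q v. Proof. by rewrite (linearmapB lP) PP PA. Qed.

Let q_le v : l2norm (q v) <= (1 + opnorm A) * l2norm v.
Proof.
apply: le_trans (ler_l2normD _ _) _; rewrite l2normN mulrDl mul1r.
by apply: lerD; [exact: proj_le | exact: opnormP].
Qed.

(* [q] is the first component of the inverse of the block matrix [[I, A], [0, I]],
   which block-diagonalises [T]. *)
Let qT v : q (T v) = T (q v).
Proof.
have [_ _ [T11i [hT11i hA]]] := syl.
pose w := v - P v.
have Pw : P w = 0 by exact: PC.
(* The Sylvester equation with T11 applied to both sides: A T22 = T12 + T11 A. *)
have ATw : A (T w) = P (T w) + P (T (A w)).
  have rw : range (fun x => x - P x) w by exists v.
  have := congr1 (fun z => P (T z)) (hA w rw).
  have T11iK z : P z = z -> P (T (T11i z)) = z.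
    by move=> Pz; have [|] := hT11i z; first by exists z.
  rewrite (linearmapB lT) (linearmapB lP) (linearmapN lT) (linearmapN lP).
  rewrite (T11iK _ (PP _)) (T11iK _ (PA _)) (linearmapB lA (T w)) AP subr0 => h.
  by rewrite -[P (T w)]opprK -h opprB subrK.
have vE : v = P v + w by rewrite addrC subrK.
have PTP : P (T (P v)) = T (P v) by apply: PT.
have ATP : A (T (P v)) = 0 by apply: A0.
have Aw : A v = A w by rewrite (linearmapB lA) AP subr0.
rewrite {1}vE (linearmapD lT) /q (linearmapD lP) (linearmapD lA) ATP add0r ATw.
by rewrite PTP (PT (PA w)) Aw (linearmapB lT (P v)) opprD addrA addrK.
Qed.

(** q takes values in ran P, so the lower bound alpha applies at each step once q has been moved
    past T. *)
Let q_iter_ge k v : alpha ^+ k * l2norm (q v) <= l2norm (q (iter k T v)).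
Proof.
elim: k => [|k ih] /=; first by rewrite mul1r.
rewrite qT; apply: le_trans (_ : alpha * l2norm (q (iter k T v)) <= _).
  by rewrite exprS -mulrA ler_wpM2l// ltW.
by apply: Tge; exists (q (iter k T v)).
Qed.

(** Invariance of ran P gives (I - P) T = T22 (I - P): the off-range component evolves by T22
    alone. *)
Let projC_iter_le k v :
  l2norm (iter k T v - P (iter k T v)) <= beta ^+ k * l2norm (v - P v).
Proof.
elim: k => [|k ih] /=; first by rewrite mul1r.
set y := iter k T v in ih *.
have -> : T y - P (T y) = T (y - P y) - P (T (y - P y)).
  rewrite {1 2}(_ : y = P y + (y - P y)); last by rewrite subrKC.
  by rewrite (linearmapD lT (P y)) (linearmapD lP (T (P y))) (PT (PP y)) opprD addrACA subrr add0r.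
have := opnormP (y - P y) bT22; rewrite PC subr0 => /le_trans; apply.
apply: le_trans (ler_wpM2r (l2norm_ge0 _) T22le) _.
by rewrite exprS -mulrA ler_wpM2l// ltW.
Qed.

Lemma opnorm_sylvester_le :
  opnorm A <= opnorm (fun x => P (T (x - P x))) / (alpha - beta).
Proof.
set tau := opnorm (fun x => P _); set N := opnorm A.
have N0 : 0 <= N by exact: opnorm_ge0.
have tau0 : 0 <= tau by exact: opnorm_ge0.
have [_ _ [T11i [hT11i hA]]] := syl.
have T11i_le z : P z = z -> l2norm (T11i z) <= l2norm z / alpha.
  move=> Pz; have [|rz _ Tz] := hT11i z; first by exists z.
  rewrite ler_pdivlMr// mulrC; apply: le_trans (Tge rz) _.
  by rewrite -[T _]PT ?Tz//; apply/(proj_rangeP oP).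
(* A = T11i A T22 - T11i T12, where |T11i| <= 1 / alpha on ran P and |T22| <= beta; solving this
   inequality for N gives the claim. *)
suff : N <= (N * beta + tau) / alpha.
  by rewrite ler_pdivlMr// ler_pdivlMr ?subr_gt0// mulrBr; lra.
apply: opnorm_le => [|x].
  by rewrite divr_ge0 ?addr_ge0 ?mulr_ge0// ltW.
pose w := x - P x.
have -> : A x = T11i (A (T w - P (T w))) - T11i (P (T w)).
  rewrite (_ : A x = A w); last by rewrite (linearmapB lA) AP subr0.
  by rewrite -hA ?subrKC//; exists x.
apply: le_trans (ler_l2normD _ _) _; rewrite l2normN.
apply: le_trans (lerD (T11i_le _ (PA _)) (T11i_le _ (PP _))) _.
rewrite -mulrDl mulrAC ler_wpM2r ?invr_ge0 ?(ltW alpha0)//.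
rewrite mulrDl; apply: lerD; last exact: opnormP.
apply: le_trans (opnormP _ bA) _; rewrite -mulrA ler_wpM2l//.
apply: le_trans (opnormP x bT22) _.
by rewrite ler_wpM2r// l2norm_ge0.
Qed.

Let S := [set x - Astar x | x in range P].

Let lAs : linear Astar.
Proof.
move=> a x y; apply: dot_eq => z.
by rewrite -adjA !dotDr !dotZr -!adjA.
Qed.

Let dot_As x : P x = x -> dot x (Astar x) = 0.
Proof. by move=> Px; rewrite -adjA A0// dot0l. Qed.

(** x - A* x = 0 with x in ran P forces x = 0, because A* x is orthogonal to x; so a basis of ran P
    is carried to a basis of S. *)
Lemma has_dim_complement n : has_dim n (range P) -> has_dim n S.
Proof.
move=> [p [ip rp]]; exists (fun i => p i - Astar (p i)).
have comb c : \sum_i c i *: (p i - Astar (p i)) =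
    \sum_i c i *: p i - Astar (\sum_i c i *: p i).
  rewrite (linearmap_comb lAs) -sumrB; apply: eq_bigr => i _.
  by rewrite scalerBr.
split=> [c|].
  rewrite comb => h; apply: ip; set x := \sum_i _ in h *.
  have Px : P x = x by apply/(proj_rangeP oP); rewrite rp; exists c.
  have := dot_As Px; have -> : Astar x = x.
    by apply/eqP; rewrite eq_sym -subr_eq0 h.
  exact: dotxx_eq0.
apply/seteqP; split=> [y [x]|_ [c ->]].
  by rewrite rp => -[c ->] <-; exists c; rewrite comb.
by rewrite comb; exists (\sum_i c i *: p i) => //; rewrite rp; exists c.
Qed.

Variable E : H -> H.
Hypotheses (oE : orthogonal_projection E) (rE : range E = S).

(** For x in ran P, <q u, x> = <u, x - A* x>, so q vanishes on the orthogonal complement of S and q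
    v = q (E v). Writing E v = x - A* x gives |E v|^2 = <E v, x - A* x> = <q (E v), x>, and |x| <=
    |E v| by Pythagoras. *)
Lemma complement_proj_le v : l2norm (E v) <= l2norm (P v - A v).
Proof.
have [lE EE sE] := oE.
have qdot u x : P x = x -> dot (q u) x = dot u (x - Astar x).
  by move=> Px; rewrite dotBl sP adjA Px dotBr.
have qE : q v = q (E v).
  apply/eqP; rewrite -subr_eq0; apply/eqP/l2norm0_eq0.
  have -> : q v - q (E v) = q (v - E v).
    exact: esym (linearmapB (linear_sub lP lA) v (E v)).
  have key x : P x = x -> dot (q (v - E v)) x = 0.
    move=> Px; rewrite qdot//; have /(proj_rangeP oE) <- : range E (x - Astar x).
      by rewrite rE; exists x => //; apply/(proj_rangeP oP).
    by rewrite -sE (linearmapB lE) EE subrr dot0l.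
  by rewrite (dotxx_eq0 (key _ (Pq _))) l2norm0.
have : S (E v) by rewrite -rE; exists v.
move=> [x /(proj_rangeP oP) Px xE]; rewrite -/(q v) qE.
have xle : l2norm x <= l2norm (E v).
  rewrite -(@ler_pXn2r _ 2)// ?nnegrE ?l2norm_ge0//.
  have := l2norm_sqD x (- Astar x); rewrite xE dotNr dot_As// oppr0 mulr0 addr0 => ->.
  by rewrite lerDl sqr_ge0.
have : l2norm (E v) ^+ 2 <= l2norm (q (E v)) * l2norm (E v).
  rewrite l2norm_sq -{2}xE -qdot//.
  apply: le_trans (Re_le_normc _) _; apply: le_trans (normc_dot_le _ _) _.
  by rewrite ler_wpM2l ?l2norm_ge0.
have [->|e0] := eqVneq (l2norm (E v)) 0; first by rewrite l2norm_ge0.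
by rewrite expr2 ler_pM2r// lt_neqAle eq_sym e0 l2norm_ge0.
Qed.

(** In the application d is the sine of the angle between E and ran P, and c the cosine of the angle
    between E and S. The two bounds [h1] and [h2] are divided by each other, which eliminates
    |v|. *)
Lemma iter_projC_le k v (d c : R) : 0 < c ->
  l2norm (v - P v) <= d * l2norm v -> c * l2norm v <= l2norm (E v) ->
  l2norm (iter k T v - P (iter k T v)) <=
    (beta / alpha) ^+ k *
    (d / c * (1 + opnorm (fun x => P (T (x - P x))) / (alpha - beta))) *
    l2norm (iter k T v).
Proof.
move=> c0 vd cv; set tau := opnorm _ / _; set y := iter k T v.
have [v0|v0] := eqVneq v 0.
  rewrite /y v0 (_ : iter k T 0 = 0); first by rewrite (linearmap0 lP) subr0 l2norm0 mulr0.
  by elim: k {y} => //= k ->; rewrite (linearmap0 lT).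
have vp : 0 < l2norm v.
  by rewrite lt_neqAle l2norm_ge0 andbT eq_sym; apply: contra v0 => /eqP/l2norm0_eq0->.
have d0 : 0 <= d.
  by rewrite -(pmulr_lge0 _ vp); apply: le_trans vd; exact: l2norm_ge0.
have h1 : alpha ^+ k * (c * l2norm v) <= (1 + tau) * l2norm y.
  apply: le_trans (_ : alpha ^+ k * l2norm (q v) <= _).
    rewrite ler_wpM2l ?exprn_ge0 ?(ltW alpha0)//.
    exact: le_trans cv (complement_proj_le v).
  apply: le_trans (q_iter_ge k v) _; apply: le_trans (q_le _) _.
  by rewrite ler_wpM2r ?l2norm_ge0// lerD2l opnorm_sylvester_le.
have h2 : l2norm (y - P y) <= beta ^+ k * (d * l2norm v).
  by apply: le_trans (projC_iter_le k v) _; rewrite ler_wpM2l ?exprn_ge0 ?(ltW beta0).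
apply: le_trans h2 _.
have ak : 0 < alpha ^+ k by rewrite exprn_gt0.
have -> : (beta / alpha) ^+ k * (d / c * (1 + tau)) * l2norm y =
    beta ^+ k * d / (alpha ^+ k * c) * ((1 + tau) * l2norm y).
  by rewrite expr_div_n; field; rewrite !gt_eqF.
have -> : beta ^+ k * (d * l2norm v) =
    beta ^+ k * d / (alpha ^+ k * c) * (alpha ^+ k * (c * l2norm v)).
  by field; rewrite !gt_eqF.
by rewrite ler_wpM2l// divr_ge0 ?mulr_ge0 ?exprn_ge0 ?(ltW beta0) ?(ltW alpha0) ?(ltW c0).
Qed.

End Block.

(* Rules out the junk value x / 0 = 0 in the quotient that the class bounds by L. *)
Lemma delta_hat_lt1 n (v : 'I_n -> H) P : lin_indep v -> has_dim n (range P) ->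
  orthogonal_projection P -> lin_indep (fun i => P (v i)) ->
  delta_hat (span v) (range P) < 1.
Proof.
move=> iv dP oP iPv; have [lP _ _] := oP.
have [K K0 hK] := lin_indep_bound iPv.
pose B := \sum_i l2norm (v i).
have B0 : 0 <= B by apply: sumr_ge0 => i _; exact: l2norm_ge0.
(* Independence of the P v_i bounds the coefficients of y by |P y|, so P is bounded below on the
   span. *)
have vle y : span v y -> l2norm y <= (B * K + 1) * l2norm (P y).
  move=> [c yE]; rewrite {y}yE; set y := \sum_i _.
  apply: le_trans (_ : B * K * l2norm (P y) <= _); last first.
    by rewrite ler_wpM2r ?l2norm_ge0// lerDl.
  apply: le_trans (ler_l2norm_sum _) _.
  rewrite -mulrA; apply: le_trans (_ : B * \sum_i normc (c i) <= _); last first.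
    by rewrite ler_wpM2l// /y (linearmap_comb lP) hK.
  rewrite mulr_sumr; apply: ler_sum => i _.
  rewrite l2normZ mulrC ler_wpM2r ?normc_ge0// /B (bigD1 i)//= lerDl.
  by apply: sumr_ge0 => j _; exact: l2norm_ge0.
pose C := B * K + 1; have C1 : 1 <= C by rewrite lerDr mulr_ge0// ltW.
have C0 : 0 < C by exact: lt_le_trans C1.
have CV : 0 < C ^- 2 <= 1.
  by rewrite invr_gt0 exprn_gt0//= invf_le1 ?exprn_gt0// exprn_ege1.
(* By Pythagoras |y| <= C |P y| means |y - P y|^2 <= (1 - C^-2) |y|^2; the 1 added in C makes C >=
   1, so the root is genuine. *)
pose r := Num.sqrt (1 - C ^- 2).
have r2 : r ^+ 2 = 1 - C ^- 2 by rewrite sqr_sqrtr//; lra.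
have r1 : 0 <= r < 1.
  rewrite sqrtr_ge0/= -(@ltr_pXn2r _ 2)// ?nnegrE ?sqrtr_ge0// r2 expr1n; lra.
apply: le_lt_trans (_ : delta_hat _ _ <= r) _; last by case/andP: r1.
apply: (@delta_hat_le _ n) => //; first by exists v.
move=> y vy; rewrite -(@ler_pXn2r _ 2)// ?nnegrE ?mulr_ge0 ?l2norm_ge0 ?(proj1 (andP r1))//.
rewrite exprMn r2; have := proj_pythagoras oP y; have := vle y vy; rewrite -/C => h1.
have : C ^- 2 * l2norm y ^+ 2 <= l2norm (P y) ^+ 2.
  rewrite mulrC ler_pdivrMr ?exprn_gt0// mulrC -exprMn.
  by rewrite ler_pXn2r ?nnegrE ?mulr_ge0 ?l2norm_ge0 ?(ltW C0)// vle.
lra.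
Qed.

Lemma sin_angle n (V : set H) P : has_dim n V -> orthogonal_projection P ->
  sin (angle V (range P)) = delta_hat V (range P).
Proof.
move=> dV oP; have := delta_hat_itv dV oP; rewrite /angle.
move: (delta_hat V (range P)) => e /andP[e0 e1].
by rewrite asinK// in_itv/= e1 (le_trans _ e0)// lerN10.
Qed.

Lemma cos_angle_le n (V : set H) P v : has_dim n V -> orthogonal_projection P ->
  V v -> cos (angle V (range P)) * l2norm v <= l2norm (P v).
Proof.
move=> dV oP Vv; have := delta_hat_itv dV oP; have := delta_hat_ub dV oP Vv.
have := proj_pythagoras oP v; rewrite /angle.
move: (l2norm_ge0 (P v)) (l2norm_ge0 v) (l2norm_ge0 (v - P v)).
move: (delta_hat V (range P)) (l2norm v) (l2norm (P v)) (l2norm (v - P v)).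
move=> e a b c b0 a0 c0 abc ce /andP[e0 e1].
rewrite cos_asin; last by rewrite e1 (le_trans _ e0)// lerN10.
rewrite -(@ler_pXn2r _ 2)// ?nnegrE ?mulr_ge0 ?sqrtr_ge0//.
rewrite exprMn sqr_sqrtr ?subr_ge0 ?expr_le1// mulrBl mul1r -exprMn.
by rewrite lerBlDr [leLHS]abc lerD2l ler_pXn2r ?nnegrE// mulr_ge0.
Qed.

Lemma cos_angle_gt0 n (V : set H) P : has_dim n V -> orthogonal_projection P ->
  delta_hat V (range P) < 1 -> 0 < cos (angle V (range P)).
Proof.
move=> dV oP; have := delta_hat_itv dV oP; rewrite /angle.
move: (delta_hat V (range P)) => e /andP[e0 _] e1.
rewrite cos_asin; last by rewrite (ltW e1) (le_trans _ e0)// lerN10.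
by rewrite sqrtr_gt0 subr_gt0 expr_lt1.
Qed.

Lemma dominant_iter_le M t L T P k v : bounded_op T ->
  dominant_projection M t L T P -> span_e M v ->
  l2norm (iter k T v - P (iter k T v)) <= t ^+ k * L * l2norm (iter k T v).
Proof.
move=> bT [oP dP invT [alpha [beta [S [/andP[b0 ba] Tge T22 [cS iS bat maxL]]]]]] ev.
have [A [As [syl adj SE]]] := cS.
(* Until S is known to be the range of a projection, [oproj S] could be its default, the zero
   map. *)
have dS : has_dim M S.
  by rewrite SE; exact: (has_dim_complement oP syl adj dP).
have [E oE rE] := has_dim_projection dS.
have a0 : 0 < alpha by exact: lt_trans ba.
have de := @has_dim_span_e R M.
move: iS maxL; rewrite -rE oprojE// => iE; rewrite ge_max => /andP[_].
have d2lt : delta_hat (@span_e R M) (range E) < 1.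
  by apply: delta_hat_lt1 => //; [exact: lin_indep_e | rewrite rE].
have c0 := cos_angle_gt0 de oE d2lt; have cv := cos_angle_le de oE ev.
rewrite (sin_angle de oP); have /andP[d0 _] := delta_hat_itv de oP.
have rES : range E = [set x - As x | x in range P] by rewrite rE.
move=> hL; apply: le_trans (iter_projC_le bT oP invT b0 ba Tge T22 syl adj oE rES k
  c0 (delta_hat_ub de oP ev) cv) _.
have ba0 : 0 <= beta / alpha by rewrite divr_ge0 ?(ltW b0) ?(ltW a0).
have t0 : 0 <= t by exact: le_trans ba0 (ltW bat).
rewrite ler_wpM2r ?l2norm_ge0//; apply: ler_pM => //.
- exact: exprn_ge0.
- rewrite mulr_ge0 ?divr_ge0 ?(ltW c0)// addr_ge0// divr_ge0 ?subr_ge0 ?(ltW ba)//.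
  apply: opnorm_ge0.
  exact: (bounded_comp (bounded_proj oP) (bounded_comp bT (bounded_projC oP))).
- by rewrite lerXn2r ?nnegrE// ltW.
Qed.

End Dominant.

(** * Continuity of the iterates in the evaluations *)

Section Density.
Variable R : realType.
Local Notation H := (ell2 R).

Definition ratc (q : rat * rat) : R[i] := Complex (ratr q.1) (ratr q.2).

Definition rat_vec (l : nat) (q : nat -> rat * rat) : H :=
  \sum_(j < l) ratc (q j) *: e_ R j.

Lemma ratc_approx (z : R[i]) (d : R) : 0 < d ->
  exists q, normc (z - ratc q) < d.
Proof.
move=> d0; have approx (a : R) : exists q : rat, `|a - ratr q| < d / 2.
  have [|q] := @rat_in_itvoo R (a - d / 2) (a + d / 2); first by lra.
  by rewrite in_itv/= => /andP[? ?]; exists q; rewrite ltr_norml; lra.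
have [[p hp] [q hq]] := (approx (complex.Re z), approx (complex.Im z)).
exists (p, q); rewrite [ltRHS](splitr d); apply: le_lt_trans (ltrD hp hq).
rewrite -(@ler_pXn2r _ 2)// ?nnegrE ?normc_ge0 ?addr_ge0// normc_sq.
rewrite /sqmod; case: z {hp hq} => a b /=.
by rewrite -[(a - _) ^+ 2]real_normK ?num_real// -[(b - _) ^+ 2]real_normK ?num_real// sqrrD
  lerD2r lerDl mulrn_wge0// mulr_ge0.
Qed.

(** [trunc] comes from a choice; the coordinate map is an orthogonal projection with the same range,
    and such a projection is unique. *)
Lemma truncE n (z : H) : trunc n z = \sum_(i < n) z i *: e_ R i.
Proof.
pose E (z : H) : H := \sum_(i < n) z i *: e_ R i.
have Eo : orthogonal_projection E.
  split.
  - move=> a x y; rewrite /E scaler_sumr -big_split/=; apply: eq_bigr => i _.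
    by rewrite scalerA -scalerDl.
  - move=> x; apply: eq_bigr => i _; congr (_ *: _).
    by rewrite -dotxE dot_sum_e ltn_ord.
  - move=> x y; rewrite dot_suml dot_sumr; apply: eq_bigr => i _.
    by rewrite dotZl dotZr (dotC y) !dotxE mulrC.
rewrite /trunc (_ : span_e n = range E) ?oprojE//.
apply/seteqP; split=> [_ [c ->]|_ [x _ <-]]; last by exists (fun i => x i).
pose d k := if insub k is Some j then c j else 0.
have dE (i : 'I_n) : d i = c i by rewrite /d valK.
have -> : \sum_(i < n) c i *: e_ R i = \sum_(i < n) d i *: e_ R i.
  by apply: eq_bigr => i _; rewrite dE.
exists (\sum_(i < n) d i *: e_ R i) => //.
by apply: eq_bigr => i _; rewrite -dotxE dot_sum_e ltn_ord.
Qed.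

Lemma trunc_projection n : orthogonal_projection (@trunc R n).
Proof.
have [P oP rP] := has_dim_projection (@has_dim_span_e R n).
by rewrite /trunc -rP oprojE.
Qed.

Lemma l2norm_sq_trunc n (z : H) :
  l2norm (trunc n z) ^+ 2 = series (fun k => sqmod (z k)) n.
Proof.
have [_ tt st] := trunc_projection n.
rewrite l2norm_sq -st tt truncE dot_suml /series/= big_mkord.
rewrite (big_morph (@complex.Re R) (id1 := 0) (op1 := +%R))//.
  apply: eq_bigr => i _; rewrite dotZl dotC dotxE.
  by rewrite /sqmod re_conjM !expr2.
by case=> ? ? [? ?].
Qed.

Lemma trunc_approx (z : H) (d : R) : 0 < d -> exists n, l2norm (z - trunc n z) < d.
Proof.
move=> d0; have cz := @sqmod_summable _ z.
have d2 : 0 < d ^+ 2 by rewrite exprn_gt0.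
have /cvgrPdist_lt/(_ _ d2)[n _ hn] := cz.
exists n; rewrite -(@ltr_pXn2r _ 2)// ?nnegrE ?l2norm_ge0 1?ltW//.
have := hn n (leqnn n); rewrite -Re_dotxx -l2norm_sq -l2norm_sq_trunc.
have := proj_pythagoras (trunc_projection n) z.
by move=> h; apply: le_lt_trans; rewrite h [_ + _ - _]addrAC subrr add0r ler_norm.
Qed.

Lemma l2norm_comb_le n (c : 'I_n -> R[i]) (v : 'I_n -> H) (B : R) :
  (forall i, l2norm (v i) <= B) ->
  l2norm (\sum_i c i *: v i) <= (\sum_i normc (c i)) * B.
Proof.
move=> vB; apply: le_trans (ler_l2norm_sum _) _; rewrite mulr_suml.
by apply: ler_sum => i _; rewrite l2normZ ler_wpM2l ?normc_ge0.
Qed.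

Lemma rat_vec_dense (z : H) (d : R) : 0 < d ->
  exists l q, l2norm (z - rat_vec l q) < d.
Proof.
move=> d0; have d20 : 0 < d / 2 by rewrite divr_gt0.
have [l hl] := trunc_approx z d20.
have e0 : 0 < d / 2 / l.+1%:R by rewrite divr_gt0.
have /choice[q hq] k : exists q, normc (z k - ratc q) < d / 2 / l.+1%:R.
  exact: ratc_approx.
exists l, q; rewrite -[z - _](subrKA (trunc l z)); apply: le_lt_trans (ler_l2normD _ _) _.
rewrite [ltRHS](splitr d); apply: ltr_leD hl _.
rewrite truncE -sumrB; under eq_bigr do rewrite -scalerBl.
apply: le_trans (@l2norm_comb_le _ _ _ 1 _) _; first by move=> i; rewrite l2norm_e.
rewrite mulr1; apply: (@le_trans _ _ (\sum_(i < l) (d / 2 / l.+1%:R))).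
  by apply: ler_sum => i _; exact: ltW.
rewrite sumr_const card_ord -[leLHS]mulr_natr -mulrA ler_piMr ?(ltW d20)//.
by rewrite mulrC ler_pdivrMr// mul1r ler_nat.
Qed.

End Density.

(** * Neighbourhoods of inputs given by finitely many evaluations *)

Section InputTopology.
Variables (R : realType) (Om : set (input R)).
Local Notation H := (ell2 R).
Implicit Types (x y : input R) (z : H).

(* Codes evaluations by a countable type. *)
Definition ev_of (c : bool * nat * nat) : evaluation :=
  if c.1.1 then Entry c.1.2 c.2 else Gval c.1.2 c.2.

(** The initial topology of the evaluations, relative to [Om], presented as a filter so that [near]
    reasoning applies. *)
Definition input_nbhs x : set_system (input R) :=
  [set Q | exists (F : seq (bool * nat * nat)) (d : R), 0 < d /\
    forall y, Om y ->
      (forall c, c \in F -> normc (evaluate y (ev_of c) - evaluate x (ev_of c)) < d) ->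
      Q y].

Global Instance input_nbhs_filter x : Filter (input_nbhs x).
Proof.
split.
- by exists [::], 1.
- move=> P Q [F [d [d0 PF]]] [G [e [e0 QG]]]; exists (F ++ G), (Num.min d e).
  split=> [|y Oy yFG]; first by rewrite lt_min d0.
  split; [apply: PF|apply: QG] => // c cF.
    by have := yFG c; rewrite mem_cat cF lt_min => /(_ isT)/andP[].
  by have := yFG c; rewrite mem_cat cF orbT lt_min => /(_ isT)/andP[].
- move=> P Q PQ [F [d [d0 PF]]]; exists F, d; split => // y Oy yF.
  exact/PQ/PF.
Qed.

Lemma near_Om x : \forall y \near input_nbhs x, Om y.
Proof. by exists [::], 1. Qed.

Lemma near_evaluate x c (d : R) : 0 < d ->
  \forall y \near input_nbhs x,
    normc (evaluate y (ev_of c) - evaluate x (ev_of c)) < d.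
Proof.
by move=> d0; exists [:: c], d; split => // y _; apply; rewrite mem_head.
Qed.

(** Makes the values of g locally constant: inputs close enough to x share its truncation index. *)
Lemma normcB_nat (a b : nat) : normc (a%:R - b%:R : R[i]) < 1 -> a = b.
Proof.
move=> h; have {h} : `|a%:R - b%:R : R| < 1.
  apply: le_lt_trans h; have -> : (a%:R - b%:R : R[i]) = (a%:R - b%:R : R)%:C%C.
    by rewrite rmorphB !rmorph_nat.
  by rewrite /= expr0n addr0 sqrtr_sqr.
have gap (m n : nat) : (m < n)%N -> 1 <= n%:R - m%:R :> R.
  by move=> mn; rewrite -natrB ?ler1n ?subn_gt0// ltnW.
by rewrite ltr_norml; case: (ltngtP a b) => // /gap ? /andP[? ?]; exfalso; lra.
Qed.

Definition input_continuous x (u : input R -> H) :=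
  forall d : R, 0 < d -> \forall y \near input_nbhs x, l2norm (u y - u x) < d.

Hypothesis admOm : forall y, Om y -> bounded_op y.1 /\ admissible y.1 y.2.

(** With 1 / (j + 1) < d / 4 and N the common value of g at (j, n), both columns are within d / 4 of
    their first N coordinates, and those are N evaluations, so closeness up to d / 2 can be imposed
    on them. *)
Lemma input_continuous_e x n : Om x -> input_continuous x (fun y => y.1 (e_ R n)).
Proof.
move=> Ox d d0; have d4 : 0 < d / 4 by rewrite divr_gt0.
have [j hj] : exists j : nat, j.+1%:R^-1 < d / 4.
  by have [j _ hj] := near_infty_natSinv_lt (PosNum d4); exists j; exact: hj (leqnn j).
pose N := x.2 j n.
have e0 : 0 < d / 2 / N.+1%:R by rewrite !divr_gt0.
have near_entries : \forall y \near input_nbhs x, forall m : 'I_N,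
    normc ((y : input R).1 (e_ R n) m - x.1 (e_ R n) m) < d / 2 / N.+1%:R.
  apply: filter_forall => m.
  apply: filterS (near_evaluate x (true, nat_of_ord m, n) e0) => y.
  have entryE (z : input R) : evaluate z (ev_of (true, nat_of_ord m, n)) = z.1 (e_ R n) m.
    exact: dotxE.
  by rewrite !entryE.
near=> y.
have Oy : Om y by near: y; exact: near_Om.
have ye (m : 'I_N) : normc (y.1 (e_ R n) m - x.1 (e_ R n) m) < d / 2 / N.+1%:R.
  by move: m; near: y; exact: near_entries.
have gE : y.2 j n = N.
  by apply: normcB_nat; near: y; exact: (near_evaluate x (false, j, n) ltr01).
have [[_ /(_ j)[_ _ /(_ n) hx]] [_ /(_ j)[_ _ /(_ n) hy]]] := (admOm Ox, admOm Oy).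
rewrite gE in hy; rewrite -/N in hx; rewrite l2normB in hy.
set a := x.1 _ in hx *; set b := y.1 _ in hy *.
have -> : b - a = b - trunc N b + (trunc N b - trunc N a) + (trunc N a - a).
  by rewrite !addrA !subrK.
apply: le_lt_trans (ler_l2normD _ _) _.
apply: le_lt_trans (lerD (ler_l2normD _ _) (lexx _)) _.
suff h : l2norm (trunc N b - trunc N a) <= d / 2.
  by have := le_lt_trans hx hj; have := le_lt_trans hy hj; clear -h; lra.
rewrite !truncE -sumrB; under eq_bigr do rewrite -scalerBl.
apply: le_trans (@l2norm_comb_le _ _ _ _ 1 _) _; first by move=> i; rewrite l2norm_e.
rewrite mulr1; apply: (@le_trans _ _ (\sum_(i < N) (d / 2 / N.+1%:R))).
  by apply: ler_sum => i _; apply/ltW; exact: ye.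
rewrite sumr_const card_ord -[leLHS]mulr_natr -mulrA ler_piMr ?divr_ge0 ?(ltW d0)//.
by rewrite mulrC ler_pdivrMr// mul1r ler_nat.
Unshelve. all: by end_near. Qed.

Variable L : R.
Hypotheses (L0 : 0 < L) (OmL : forall y z, Om y -> l2norm (y.1 z) <= L * l2norm z).

Lemma input_continuous_apply x (u : input R -> H) : Om x ->
  input_continuous x u -> input_continuous x (fun y => y.1 (u y)).
Proof.
(* The operators vary continuously only on each finitely supported vector, so u x is replaced by
   such a z. The budget is 2 d / 6 for y (u y - z), d / 2 for y z - x z and d / 6 for x (z - u x),
   the first and last through the uniform bound L. *)
move=> Ox cu d d0; have d6 : 0 < d / (6 * L) by rewrite divr_gt0// mulr_gt0.
have [l [q hz]] := rat_vec_dense (u x) d6; set z := rat_vec _ l q in hz.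
pose B := \sum_(i < l) normc (ratc R (q i)).
have B0 : 0 <= B by apply: sumr_ge0 => i _; exact: normc_ge0.
have e0 : 0 < d / 2 / (B + 1) by rewrite !divr_gt0// ltr_wpDl.
have near_z : \forall y \near input_nbhs x, forall i : 'I_l,
    l2norm ((y : input R).1 (e_ R i) - x.1 (e_ R i)) < d / 2 / (B + 1).
  by apply: filter_forall => i; exact: input_continuous_e.
near=> y.
have Oy : Om y by near: y; exact: near_Om.
have yz (i : 'I_l) : l2norm (y.1 (e_ R i) - x.1 (e_ R i)) < d / 2 / (B + 1).
  by move: i; near: y; exact: near_z.
have uy : l2norm (u y - u x) < d / (6 * L) by near: y; exact: cu.
have [[[lx _] _] [[ly _] _]] := (admOm Ox, admOm Oy).
have -> : y.1 (u y) - x.1 (u x) = y.1 (u y - z) + (y.1 z - x.1 z) + x.1 (z - u x).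
  by rewrite (linearmapB ly) (linearmapB lx) !addrA !subrK.
apply: le_lt_trans (ler_l2normD _ _) _.
apply: le_lt_trans (lerD (ler_l2normD _ _) (lexx _)) _.
have h1 : l2norm (u y - z) < d / (6 * L) + d / (6 * L).
  by rewrite -[u y - z](subrKA (u x)); exact: le_lt_trans (ler_l2normD _ _) (ltrD uy hz).
have h2 : l2norm (z - u x) < d / (6 * L) by rewrite l2normB.
have h3 : l2norm (y.1 z - x.1 z) <= d / 2.
  rewrite /z /rat_vec (linearmap_comb ly) (linearmap_comb lx) -sumrB.
  under eq_bigr do rewrite -scalerBr.
  apply: le_trans (@l2norm_comb_le _ _ _ _ (d / 2 / (B + 1)) _) _.
    by move=> i; apply/ltW; exact: yz.
  rewrite -/B mulrCA ler_piMr ?divr_ge0 ?(ltW d0)// ler_pdivrMr ?ltr_wpDl//.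
  by rewrite mul1r lerDl.
have Ld : L * (d / (6 * L)) = d / 6 by field; rewrite gt_eqF.
have h4 : L * l2norm (u y - z) < d / 6 + d / 6.
  by rewrite -Ld -mulrDr ltr_pM2l.
have h5 : L * l2norm (z - u x) < d / 6 by rewrite -Ld ltr_pM2l.
have := OmL (u y - z) Oy; have := OmL (z - u x) Ox; clear -h3 h4 h5; lra.
Unshelve. all: by end_near. Qed.

Lemma input_continuous_iter x k n : Om x ->
  input_continuous x (fun y => iter k y.1 (e_ R n)).
Proof.
move=> Ox; elim: k => [|k ih] /=; last exact: input_continuous_apply.
by move=> d d0; apply: nearW => y; rewrite subrr l2norm0.
Qed.

End InputTopology.

(** * Search through rational certificates *)

Section Search.
Variables (R : realType) (Om : set (input R)) (M : nat).
Local Notation H := (ell2 R).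

Definition rat_span (l : nat) (w : 'I_M -> nat -> rat * rat) : set H :=
  span (fun i => rat_vec R l (w i)).

(* A ball of evaluations around rational centres, of rational squared radius,
   followed by the dimension and the coordinates of a rational answer. *)
Definition certificate : Type :=
  seq (bool * nat * nat * (rat * rat)) * rat * nat * {ffun 'I_M -> seq (rat * rat)}.

Definition cert_test (c : certificate) : seq (bool * nat * nat * (rat * rat)) := c.1.1.1.
Definition cert_radius (c : certificate) : rat := c.1.1.2.
Definition cert_dim (c : certificate) : nat := c.1.2.
(** Stored as finite lists padded by zeros, so that certificates form a countable type. *)
Definition cert_coef (c : certificate) (i : 'I_M) (j : nat) : rat * rat :=
  nth (0, 0) (c.2 i) j.

Definition cert_space (c : certificate) : set H :=
  rat_span (cert_dim c) (cert_coef c).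

Definition cert_dist (c : certificate) (y : input R) : R :=
  \sum_(e <- cert_test c) sqmod (evaluate y (ev_of e.1) - ratc R e.2).

Definition certifies (c : certificate) (y : input R) : bool :=
  cert_dist c y < ratr (cert_radius c).

Definition cert_reads (c : certificate) : set evaluation :=
  [set ev_of e.1 | e in [set` cert_test c]].

Definition sqr_term (u : term) : term := Mul u u.

(** Using squared moduli, the test contains no division or root, and [legal] only concerns which
    evaluations are read. *)
Definition dist_term (F : seq (bool * nat * nat * (rat * rat))) : term :=
  foldr (fun e u => Add
      (Add (sqr_term (Sub (ReEval (ev_of e.1)) (Const e.2.1)))
           (sqr_term (Sub (ImEval (ev_of e.1)) (Const e.2.2)))) u)
    (Const 0) F.

Lemma value_dist_term par (y : input R) c :
  value par y (dist_term (cert_test c)) = cert_dist c y.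
Proof.
rewrite /cert_dist; elim: (cert_test c) => [|e F ih] /=.
  by rewrite big_nil rmorph0.
rewrite big_cons ih /sqmod; congr (_ + _).
by case: (evaluate y _) => a b /=; rewrite !expr2.
Qed.

Lemma legal_dist_term par (y : input R) c (Lam : set evaluation) :
  cert_reads c `<=` Lam -> legal par y Lam (dist_term (cert_test c)).
Proof.
rewrite /cert_reads; elim: (cert_test c) => //= e F ih FL.
have eL : Lam (ev_of e.1) by apply: FL; exists e => //=; rewrite mem_head.
by do !split => //; apply: ih => _ [f /= fF <-]; apply: FL; exists f => //=;
  rewrite inE fF orbT.
Qed.

(** Centres within m of the evaluations of x, where (|F| + 1) m^2 = r, put x inside the ball; r < (d
    / 2)^2 keeps each evaluation of a member within d / 2 of its centre, hence within d of that of
    x. *)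
Lemma near_certificate (x : input R) l w (Q : set (input R)) : Om x ->
  input_nbhs Om x Q -> exists c : certificate,
    [/\ certifies c x, cert_space c = rat_span l w &
        forall y, Om y -> certifies c y -> Q y].
Proof.
move=> Ox [F [d [d0 FQ]]].
have [|r] := @rat_in_itvoo R 0 ((d / 2) ^+ 2); first by rewrite exprn_gt0// divr_gt0.
rewrite in_itv/= => /andP[r0 rd].
pose m := Num.sqrt (ratr r / (size F).+1%:R : R).
have m0 : 0 < m by rewrite sqrtr_gt0 divr_gt0.
have mr : m ^+ 2 = ratr r / (size F).+1%:R by rewrite sqr_sqrtr// ltW// divr_gt0.
have /choice[q hq] c : exists q, normc (evaluate x (ev_of c) - ratc R q) < m.
  exact: ratc_approx.
pose c : certificate := ([seq (e, q e) | e <- F], r, l,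
  [ffun i => mkseq (w i) l]).
have distE y : cert_dist c y = \sum_(e <- F) sqmod (evaluate y (ev_of e) - ratc R (q e)).
  by rewrite /cert_dist /cert_test /= big_map.
have cx : certifies c x.
  rewrite /certifies distE /cert_radius /=.
  apply: (@le_lt_trans _ _ (\sum_(e <- F) (ratr r / (size F).+1%:R : R))).
    apply: ler_sum => e _; rewrite -normc_sq.
    by rewrite -mr ler_pXn2r ?nnegrE ?normc_ge0 ?(ltW m0)// ltW.
  rewrite big_const_seq count_predT iter_addr_0 -[ltLHS]mulr_natr mulrAC.
  by rewrite ltr_pdivrMr// ltr_pM2l// ltr_nat.
have close y e : certifies c y -> e \in F ->
    normc (evaluate y (ev_of e) - ratc R (q e)) < d / 2.
  rewrite /certifies distE /cert_radius /= => cy eF.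
  rewrite -(@ltr_pXn2r _ 2)// ?nnegrE ?normc_ge0 ?divr_ge0 ?(ltW d0)//.
  apply: le_lt_trans rd; apply: le_trans (ltW cy).
  rewrite normc_sq (big_rem e)//= lerDl.
  by apply: sumr_ge0 => ? _; exact: sqmod_ge0.
exists c; split=> //.
  rewrite /cert_space /rat_span; congr span; apply/funext => i.
  apply: eq_bigr => j _; congr (ratc R _ *: _).
  by rewrite /cert_coef /= ffunE nth_mkseq.
move=> y Oy cy; apply: FQ => // e eF.
have := close y e cy eF; have := close x e cx eF.
set a := evaluate y _; set b := evaluate x _ => hb ha.
rewrite -[a - b](subrKA (ratc R (q e))); apply: le_lt_trans (le_normcD _ _) _.
by rewrite [ltRHS](splitr d) ltrD// -normcN opprB.
Qed.

(** * The decision tree that runs through the certificates *)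

Section Enumeration.
Variable valid : certificate -> Prop.

Definition cert_at (k : nat) : option certificate :=
  if unpickle k is Some c then if `[< valid c >] then Some c else None else None.

(** A code without valid certificate asks whether 0 < 0, so the search always passes over it. *)
Definition query (k : nat) : term * term :=
  if cert_at k is Some c
  then (dist_term (cert_test c), Const (cert_radius c)) else (Const 0, Const 0).

Definition answer (k : nat) : tree :=
  if cert_at k is Some c
  then Output (fun (i : 'I_M) (j : 'I_(cert_dim c)) =>
                 (Const (cert_coef c i j).1, Const (cert_coef c i j).2))
  else Output (fun (i : 'I_M) (j : 'I_0) => (Const 0, Const 0)).

CoFixpoint search (k : nat) : tree :=
  Less (query k).1 (query k).2 (answer k) (search k.+1).

Definition hit (k : nat) (y : input R) : bool :=
  if cert_at k is Some c then certifies c y else false.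

Definition reads (k : nat) : set evaluation :=
  if cert_at k is Some c then cert_reads c else set0.

Definition output (k : nat) : set H :=
  if cert_at k is Some c then cert_space c else set0.

Definition stage (y : input R) : nat :=
  if pselect (exists k, hit k y) is left h then ex_minn h else 0.

(** The failed tests are included: an input agreeing on this set fails them too and stops at the
    same stage. *)
Definition stage_reads (y : input R) : set evaluation :=
  \bigcup_(k in `I_(stage y).+1) reads k.

(** A cofixpoint unfolds only under a [match], hence the rewriting by a trivial case analysis. *)
Lemma searchE k : search k = Less (query k).1 (query k).2 (answer k) (search k.+1).
Proof.
have treeE (p : tree) : p = match p with
    Less u v p q => Less u v p q | Output k l W => Output W end by case: p.
by rewrite [LHS]treeE.
Qed.

Lemma value_query par y k :
  (value par y (query k).1 < value par y (query k).2) = hit k y.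
Proof.
rewrite /query /hit; case: (cert_at k) => [c|] /=; last by rewrite ltxx.
by rewrite value_dist_term.
Qed.

Lemma legal_query (par : seq R) (y : input R) k Lam : reads k `<=` Lam ->
  legal par y Lam (query k).1 /\ legal par y Lam (query k).2.
Proof.
rewrite /reads /query; case: (cert_at k) => [c|] //= cL; split=> //.
exact: legal_dist_term.
Qed.

Lemma stage_hit y : (exists k, hit k y) ->
  hit (stage y) y /\ forall k, (k < stage y)%N -> hit k y = false.
Proof.
move=> h; rewrite /stage; case: pselect => // h'; case: ex_minnP => k hk kmin.
split=> // j jk; apply/negbTE; apply: contraL jk => /kmin.
by rewrite -leqNgt.
Qed.

Lemma stage_eq x y : (exists k, hit k x) ->
  (forall k, (k <= stage x)%N -> hit k y = hit k x) -> stage y = stage x.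
Proof.
move=> hx xy; have [hsx minx] := stage_hit hx.
have [|hsy miny] := @stage_hit y; first by exists (stage x); rewrite xy.
have := xy (stage x) (leqnn _); rewrite hsx => hyx.
apply/eqP; rewrite eqn_leq; apply/andP; split; rewrite leqNgt; apply/negP => lt.
  by rewrite miny in hyx.
by have := xy _ (ltnW lt); rewrite hsy minx.
Qed.

Lemma hit_agree x y k : (forall f, reads k f -> evaluate y f = evaluate x f) ->
  hit k y = hit k x.
Proof.
rewrite /hit /reads; case: (cert_at k) => // c xy; congr (_ < _).
by apply: eq_big_seq => e ec; rewrite xy//; exists e.
Qed.

Lemma computes_search par y : (exists k, hit k y) ->
  computes par y (stage_reads y) (search 0) (output (stage y)).
Proof.
move=> hy; have [hs mins] := stage_hit hy.
have sub k : (k <= stage y)%N -> reads k `<=` stage_reads y.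
  by move=> ky f kf; exists k.
(* Induction on the number n of tests left, since a derivation of [computes] is built up from the
   leaf. *)
suff comp n k : (n + k = stage y)%N ->
    computes par y (stage_reads y) (search k) (output (stage y)).
  by apply: (comp (stage y)); rewrite addn0.
elim: n k => [|n ih] k nk; rewrite searchE.
  have [lu lv] := legal_query par y (sub k (eq_leq nk)).
  apply: computes_less => //; rewrite value_query -nk add0n.
  move: hs; rewrite -nk add0n => hk; rewrite hk.
  move: hk; rewrite /hit /answer /output; case: (cert_at k) => // c _.
  exact: (@computes_output _ _ _ _ _ _ (fun i j => (Const _, Const _))).
have kl : (k < stage y)%N by rewrite -nk addSn ltnS leq_addl.
have [lu lv] := legal_query par y (sub k (ltnW kl)).
apply: computes_less => //; rewrite value_query mins//; apply: ih.
by rewrite addnS -addSn.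
Qed.

Lemma radical_search par : (forall x, Om x -> exists k, hit k x) ->
  radical_algorithm par Om (fun x => output (stage x)) stage_reads.
Proof.
move=> hOm; split=> [x Ox|]; last first.
  by exists (search 0) => x Ox; apply: computes_search; exact: hOm.
split.
  apply: bigcup_finite; first exact: finite_II.
  move=> k _; rewrite /reads; case: (cert_at k) => // c.
  exact/finite_image/finite_seq.
move=> y Oy xy; suff e : stage y = stage x by rewrite /stage_reads e.
apply: stage_eq (hOm x Ox) _ => k ks; apply: hit_agree => f kf.
by apply: xy; exists k.
Qed.

End Enumeration.

(* A tree need not be computable, so it may enumerate exactly those certificates
   whose answer is right on the whole of their box. *)
Lemma Delta1_locally (par : seq R) (MM : set (set H)) (d : set H -> set H -> R)
    (Xi : input R -> set H) :
  (forall (n : nat) x, Om x -> exists l w,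
     MM (rat_span l w) /\
     \forall y \near input_nbhs Om x, d (rat_span l w) (Xi y) <= 2 ^- n) ->
  Delta1 par Om MM d Xi.
Proof.
move=> loc.
suff /choice[G hG] n : exists GL : (input R -> set H) * (input R -> set evaluation),
    radical_algorithm par Om GL.1 GL.2 /\
    forall x, Om x -> MM (GL.1 x) /\ d (GL.1 x) (Xi x) <= 2 ^- n.
  by exists (fun n => (G n).1), (fun n => (G n).2).
pose valid (c : certificate) := MM (cert_space c) /\
  forall y, Om y -> certifies c y -> d (cert_space c) (Xi y) <= 2 ^- n.
have hOm x : Om x -> exists k, hit valid k x.
  move=> Ox; have [l [w [Mw dw]]] := loc n x Ox.
  have [c [cx cE cy]] := near_certificate l w Ox dw.
  exists (pickle c); rewrite /hit /cert_at pickleK asboolT// /valid cE.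
  by split.
exists (fun x => output valid (stage valid x), stage_reads valid).
split=> [|x Ox] /=; first exact: radical_search.
have [] := stage_hit (hOm x Ox); rewrite /hit /output /cert_at.
case: unpickle => // c; case: asboolP => // -[Mc dc] cx _.
by split; last exact: dc.
Qed.

End Search.

(** * Rational subspaces that approximate the dominant subspace locally *)

Section DominantSubspaceInputs.
Variables (R : realType) (M : nat) (t L : R).
Hypotheses (t01 : 0 < t < 1) (L0 : 0 < L).
Local Notation H := (ell2 R).
Local Notation Om := (inputs (Omega_tilde M t L)).

Lemma rat_vec_widen l l' (q : nat -> rat * rat) : (l <= l')%N ->
  rat_vec R l' (fun j => if (j < l)%N then q j else (0, 0)) = rat_vec R l q.
Proof.
move=> ll'; rewrite /rat_vec (big_ord_widen _ (fun j => ratc R (q j) *: e_ R j) ll').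
rewrite [RHS]big_mkcond/=; apply: eq_bigr => j _; case: ifP => // _.
by rewrite /ratc /= rmorph0 scale0r.
Qed.

(** All vectors of an [Output] share one support length, hence the maximum and the padding by
    zeros. *)
Lemma rat_vecs_dense (u : 'I_M -> H) (d : R) : 0 < d ->
  exists l w, forall i, l2norm (u i - rat_vec R l (w i)) < d.
Proof.
move=> d0; have /choice[lq hlq] i : exists lq : nat * (nat -> rat * rat),
    l2norm (u i - rat_vec R lq.1 lq.2) < d.
  by have [l [q h]] := rat_vec_dense (u i) d0; exists (l, q).
exists (\max_i (lq i).1)%N,
  (fun i j => if (j < (lq i).1)%N then (lq i).2 j else (0, 0)) => i.
by rewrite rat_vec_widen// (leq_bigmax i).
Qed.

(** [Xi3] is a choice among ranges; the estimates hold for whichever dominant projection it comes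
    from. *)
Lemma Xi3P T : Omega_tilde M t L T ->
  exists2 P, dominant_projection M t L T P & Xi3 M t L T = range P.
Proof.
move=> [_ [P domP]]; rewrite /Xi3.
have [|P' [domP' ->]] := xgetPex set0 (_ : exists V,
  [set V | exists P, dominant_projection M t L T P /\ V = range P] V).
  by exists (range P), P.
by exists P'.
Qed.

Lemma Omega_tilde_le T z : Omega_tilde M t L T -> l2norm (T z) <= L * l2norm z.
Proof.
move=> [[bT _] [P [_ _ _ [alpha [beta [S [_ _ _ [_ _ _]]]]]]]].
rewrite ge_max => /andP[TL _]; apply: le_trans (opnormP z bT) _.
by rewrite ler_wpM2r ?l2norm_ge0.
Qed.

(** Invertibility of T makes T^k injective, so T^k E keeps dimension M. *)
Lemma lin_indep_iter T (k : nat) : Omega_tilde M t L T ->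
  lin_indep (fun i : 'I_M => iter k T (e_ R i)).
Proof.
move=> [[[lT _] [T' [_ TK _]]] _].
have lTk : linear (iter k T).
  by elim: k => // k ih a x y /=; rewrite ih lT.
have Tk0 x : iter k T x = 0 -> x = 0.
  elim: k {lTk} => //= k ih h; apply: ih; rewrite -(TK (iter k T x)) h.
  by rewrite -{1}(linearmap0 lT) TK.
move=> c; rewrite -(linearmap_comb lTk) => /Tk0; exact: lin_indep_e.
Qed.

(* The bound sum |c_i| <= K |sum c_i u_i| for the iterates u_i of x holds with 2K
   for rational approximations v_i of the u_i; it makes the distance of
   sum c_i v_i to the iterates of a nearby input small relative to its norm. *)
Lemma delta_hat_locally (n : nat) x : Om x -> exists l w,
  has_dim M (@rat_span R M l w) /\
  \forall y \near input_nbhs Om x, delta_hat (@rat_span R M l w) (Xi3 M t L (y : input R).1) <= 2 ^- n.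
Proof.
move=> Ox; have [Tx _] := Ox; have /andP[t0 t1] := t01.
pose rho : R := 2 ^- n.
have rho0 : 0 < rho by rewrite invr_gt0 exprn_gt0.
have rho1 : rho <= 1 by rewrite invf_le1 ?exprn_gt0// exprn_ege1// ler1n.
have [k tk] : exists k, t ^+ k * L < rho / 4.
  have e0 : 0 < rho / 4 / L by rewrite !divr_gt0.
  have tn1 : `|t| < 1 by rewrite gtr0_norm.
  have /cvgrPdist_lt/(_ _ e0)[k _ hk] := cvg_expr tn1.
  exists k; rewrite -ltr_pdivlMr//; apply: le_lt_trans (hk k (leqnn k)).
  by rewrite sub0r normrN ler_norm.
pose u (y : input R) (i : 'I_M) : H := iter k y.1 (e_ R i).
have [K K0 hK] := lin_indep_bound (@lin_indep_iter _ k Tx).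
(* Serves two estimates: d K <= 1 / 16 lets the constant K pass to 2 K for the v_i, and (2 K) (2 d)
   = rho / 4 bounds |b - a| relative to |b| below. *)
pose d := rho / (16 * K).
have d0 : 0 < d by rewrite divr_gt0// mulr_gt0.
have dK : d * K = rho / 16 by rewrite /d; field; rewrite gt_eqF.
have [l [w hw]] := rat_vecs_dense (u x) d0.
pose v (i : 'I_M) := rat_vec R l (w i).
have diff (a b : 'I_M -> H) (c : 'I_M -> R[i]) (e : R) :
    (forall i, l2norm (a i - b i) <= e) ->
    l2norm (\sum_i c i *: a i - \sum_i c i *: b i) <= (\sum_i normc (c i)) * e.
  move=> ab; rewrite -sumrB; under eq_bigr do rewrite -scalerBr.
  exact: l2norm_comb_le.
have hKv c : \sum_i normc (c i) <= 2 * K * l2norm (\sum_i c i *: v i).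
  set s := \sum_i normc (c i); set b := \sum_i c i *: v i.
  pose a := \sum_i c i *: u x i; have sa : s <= K * l2norm a by exact: hK.
  have s0 : 0 <= s by apply: sumr_ge0 => ? _; exact: normc_ge0.
  have ab : l2norm (a - b) <= s * d by apply: diff => i; exact: ltW.
  have ale : l2norm a <= s * d + l2norm b.
    by rewrite -[a](subrK b); apply: le_trans (ler_l2normD _ _) _; rewrite lerD2r.
  have : s <= s * (d * K) + K * l2norm b.
    apply: le_trans sa _; rewrite mulrA [s * d * K]mulrC -mulrDr.
    by rewrite ler_wpM2l// ltW.
  rewrite dK; have : s * (rho / 16) <= s * (1 / 16).
    by rewrite ler_wpM2l// ler_wpM2r.
  by clear -s0; lra.
have iv : lin_indep v.
  move=> c c0 i; apply: eq0_normc; apply/eqP; rewrite eq_le normc_ge0 andbT.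
  have := hKv c; rewrite c0 l2norm0 mulr0; apply: le_trans.
  by rewrite (bigD1 i)//= lerDl; apply: sumr_ge0 => ? _; exact: normc_ge0.
have dimv : has_dim M (@rat_span R M l w) by exists v.
exists l, w; split=> //.
have near_u : \forall y \near input_nbhs Om x, forall i : 'I_M,
    l2norm (u y i - u x i) < d.
  apply: filter_forall => i; apply: (@input_continuous_iter R Om _ L L0) => //.
    by move=> y [[[bT _] _] adm].
  by move=> y z [Ty _]; exact: Omega_tilde_le.
near=> y.
have [Ty _] : Om y by near: y; exact: near_Om.
have uy i : l2norm (u y i - u x i) < d by move: i; near: y.
have [P domP ->] := Xi3P Ty; have [oP dP _ _] := domP; have [lP _ _] := oP.
have [[[lT CT] _] _] := Ty.
have bT : bounded_op y.1 by [].
(* For n = 0 the target rho is 1, whereas [delta_hat_le] wants a ratio below 1. The errors |b - a|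
   <= rho / 4 |b| and |a - P a| <= rho / 4 (1 + rho / 4) |b| add up to at most 9 / 16 rho |b|. *)
apply: le_trans (_ : rho * (3 / 4) <= _); last by rewrite -/rho; lra.
apply: (delta_hat_le dimv dP oP); first by apply/andP; split; lra.
move=> _ [c ->]; set b := \sum_i c i *: v i.
pose a := \sum_i c i *: u y i.
have ab : l2norm (b - a) <= rho / 4 * l2norm b.
  apply: le_trans (_ : (\sum_i normc (c i)) * (2 * d) <= _).
    apply: diff => i; rewrite l2normB -[u y i - v i](subrKA (u x i)).
    apply: le_trans (ler_l2normD _ _) _; apply: ltW.
    by rewrite mulr_natl mulr2n ltrD// hw.
  have -> : rho / 4 = 2 * K * (2 * d) by rewrite mulrACA [K * d]mulrC dK; field.
  have d20 : 0 <= 2 * d by rewrite mulr_ge0// ltW.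
  by rewrite [leRHS]mulrAC; exact: (ler_wpM2r d20 (hKv c)).
have aP : l2norm (a - P a) <= rho / 4 * l2norm a.
  have lTk : linear (iter k y.1) by elim: (k) => // j ih e z z' /=; rewrite ih lT.
  have -> : a = iter k y.1 (\sum_i c i *: e_ R i) by rewrite (linearmap_comb lTk).
  apply: le_trans (@dominant_iter_le _ M t L _ _ k _ bT domP _) _; first by exists c.
  by rewrite ler_wpM2r ?l2norm_ge0// ltW.
have bE : b - P b = (b - a) - P (b - a) + (a - P a).
  by rewrite addrACA subrK -opprD -(linearmapD lP) subrK.
have ale : l2norm a <= l2norm b + rho / 4 * l2norm b.
  rewrite -[a](subrKC b); apply: le_trans (ler_l2normD _ _) _.
  by rewrite lerD2l l2normB.
rewrite bE; apply: le_trans (ler_l2normD _ _) _.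
apply: le_trans (lerD (projC_le oP _) aP) _.
have := l2norm_ge0 b; move: ab ale rho0 rho1; clear.
move: (l2norm (b - a)) (l2norm a) (l2norm b) => p q s h1 h2 r0 r1 s0.
have : rho / 4 * q <= rho / 4 * (s + rho / 4 * s) by rewrite ler_wpM2l//; lra.
have : rho / 4 * (rho / 4 * s) <= rho / 4 * (1 / 4 * s).
  by rewrite ler_wpM2l ?ler_wpM2r//; lra.
rewrite mulrDr; have : 0 <= rho * s by rewrite mulr_ge0 ?(ltW r0).
lra.
Unshelve. all: by end_near. Qed.

End DominantSubspaceInputs.

Theorem theorem5p6 (R : realType) (M : nat) (t L : R)
    (hM : (0 < M)%N) (ht : 0 < t < 1) (hL : 0 < L) :
  @Delta1 R [:: t; L] (inputs (Omega_tilde M t L)) (has_dim M) (@delta_hat R)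
    (fun x => Xi3 M t L x.1).
Proof.
apply: (@Delta1_locally _ _ M) => n x Ox.
exact: delta_hat_locally.
Qed.
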